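(* Let $M,T,N_{\rm c}$ be positive integers, let $\bm{R}\in\mathbb{C}^{M\times M}$ be Hermitian positive definite, and let $\bm{u}_{\max}$ be a unit-norm eigenvector of $\bm{R}$ for its largest eigenvalue. A first-order optimal ISAC waveform can be chosen to be rank-one in space and flash in time, of the form $$\mathsf{X}_{\rm opt}=\sqrt{MT}\,\bm{u}_{\max}\,\xi\,\bm{e}_1^{\top},$$ where $\bm{e}_1\in\mathbb{C}^T$ is the first standard basis vector and $\xi$ is a complex random scalar with $\mathbb{E}[|\xi|^2]=1$ and a peaky (flash) distribution. Precisely: there is a family of distributions of $\xi$, indexed by $\mathrm{SNR}_{\rm c}>0$, with $\mathbb{E}[|\xi|^2]=1$ for every $\mathrm{SNR}_{\rm c}$ and $\mathbb{P}[\xi=0]\to1$ as $\mathrm{SNR}_{\rm c}\to0$, such that (i) (sensing) $\bm{\Sigma}=\mathbb{E}[\mathsf{X}_{\rm opt}\mathsf{X}_{\rm opt}^{H}]$ maximizes $\mathrm{tr}(\bm{R}^2\bm{\Sigma})$ over all $\bm{\Sigma}\succeq\bm{0}$ with $\mathrm{tr}(\bm{\Sigma})=MT$; (ii) (communication) as $\mathrm{SNR}_{\rm c}\to0$, $$\frac1T\,I(\mathsf{X}_{\rm opt};\mathsf{H}_{\rm c}\mathsf{X}_{\rm opt}+\mathsf{Z}_{\rm c})=N_{\rm c}\log_2(e)\,\mathrm{SNR}_{\rm c}+o(\mathrm{SNR}_{\rm c}).$$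
   Context: $\mathsf{H}_{\rm c}\in\mathbb{C}^{N_{\rm c}\times M}$ has i.i.d. $\mathcal{CN}(0,1)$ entries, $\mathsf{Z}_{\rm c}\in\mathbb{C}^{N_{\rm c}\times T}$ has i.i.d. $\mathcal{CN}(0,\sigma_{\rm c}^2)$ entries, $\mathrm{SNR}_{\rm c}=M/\sigma_{\rm c}^2$, and $\mathsf{H}_{\rm c},\mathsf{Z}_{\rm c},\xi$ are mutually independent; $\mathsf{H}_{\rm c}$ is unknown to transmitter and receiver. $I$ is mutual information in bits. Under the power constraint $\mathbb{E}[\mathrm{tr}(\mathsf{X}\mathsf{X}^{H})]=MT$, the noncoherent capacity $\sup T^{-1}I(\mathsf{X};\mathsf{H}_{\rm c}\mathsf{X}+\mathsf{Z}_{\rm c})$ has low-SNR expansion $N_{\rm c}\log_2(e)\,\mathrm{SNR}_{\rm c}+o(\mathrm{SNR}_{\rm c})$, so (ii) means first-order communication optimality. $\bm{R}$ is the correlation matrix $\mathbb{E}[\mathsf{H}_{\rm s}^{H}\mathsf{H}_{\rm s}]$ of the sensing channel; the sensing metric $J_{\rm EMMSE}=\mathbb{E}[\mathrm{tr}((\bm{R}^{-1}+\kappa\mathsf{X}\mathsf{X}^{H})^{-1})]$, with $\kappa>0$ proportional to the sensing SNR, satisfies $J_{\rm EMMSE}=\mathrm{tr}(\bm{R})-\kappa\,\mathrm{tr}(\bm{R}^2\,\mathbb{E}[\mathsf{X}\mathsf{X}^{H}])+o(\kappa)$ as $\kappa\to0$, so (i) means first-order sensing optimality. *)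

(* Defs.v *)
From HB Require Import structures.
From mathcomp Require Import all_boot all_order all_algebra.
From mathcomp Require Import all_classical all_reals all_analysis.
From mathcomp Require Import measurable_realfun complex.
Set Implicit Arguments.
Unset Strict Implicit.
Unset Printing Implicit Defensive.
Import Order.TTheory GRing.Theory Num.Theory.
Import numFieldTopology.Exports numFieldNormedType.Exports.
Local Open Scope classical_set_scope.
Local Open Scope complex_scope.
Local Open Scope sesquilinear_scope.
Local Open Scope ring_scope.

Definition measure_complex_display : measure_display -> measure_display.
Proof. exact. Qed.

Definition measure_mx_display : measure_display -> measure_display.
Proof. exact. Qed.

(* The Borel sigma-algebra of R[i], identified with R * R. *)
Section complex_measurable.
Context {R : realType}.

HB.instance Definition _ := isPointed.Build R[i] 0.

Let c_measurable : set (set R[i]) :=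
  g_sigma_preimageU (@complex.Re R) (@complex.Im R).

Let c_measurable0 : c_measurable set0.
Proof. exact: sigma_algebra0. Qed.

Let c_measurableC A : c_measurable A -> c_measurable (~` A).
Proof. exact: sigma_algebraC. Qed.

Let c_measurable_bigcup (F : (set R[i])^nat) :
  (forall k, c_measurable (F k)) -> c_measurable (\bigcup_k F k).
Proof. exact: sigma_algebra_bigcup. Qed.

HB.instance Definition _ :=
  @isMeasurable.Build (measure_complex_display default_measure_display)
    R[i] c_measurable c_measurable0 c_measurableC c_measurable_bigcup.

Lemma measurable_fun_complexP d (T : measurableType d) (f : T -> R[i]) :
  measurable_fun setT f <->
  measurable_fun setT (fun x => complex.Re (f x)) /\
  measurable_fun setT (fun x => complex.Im (f x)).
Proof.
split=> [mf|[mre mim]].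
- split=> _ A mA.
  + by apply: (mf measurableT (@complex.Re R @^-1` A)); apply: sub_sigma_algebra;
      left; exists A => //; rewrite setTI.
  + by apply: (mf measurableT (@complex.Im R @^-1` A)); apply: sub_sigma_algebra;
      right; exists A => //; rewrite setTI.
- apply: measurability; first reflexivity.
  move=> _ [_ [[A mA <-]|[A mA <-]] <-]; rewrite !setTI.
  + by have := mre measurableT A mA; rewrite setTI.
  + by have := mim measurableT A mA; rewrite setTI.
Qed.

End complex_measurable.

(* The coarsest sigma-algebra making all entries measurable. *)
Section mx_measurable.
Context d (T : measurableType d) (m n : nat).

Let mx_measurable : set (set 'M[T]_(m, n)) :=
  <<s \bigcup_ij preimage_set_system setT
        (fun A : 'M[T]_(m, n) => A ij.1 ij.2) measurable >>.

Let mx_measurable0 : mx_measurable set0.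
Proof. exact: sigma_algebra0. Qed.

Let mx_measurableC A : mx_measurable A -> mx_measurable (~` A).
Proof. exact: sigma_algebraC. Qed.

Let mx_measurable_bigcup (F : (set 'M[T]_(m, n))^nat) :
  (forall k, mx_measurable (F k)) -> mx_measurable (\bigcup_k F k).
Proof. exact: sigma_algebra_bigcup. Qed.

HB.instance Definition _ :=
  @isMeasurable.Build (measure_mx_display d)
    'M[T]_(m, n) mx_measurable mx_measurable0 mx_measurableC
    mx_measurable_bigcup.

Lemma measurable_fun_mxP d' (U : measurableType d') (f : U -> 'M[T]_(m, n)) :
  measurable_fun setT f <-> forall i j, measurable_fun setT (fun x => f x i j).
Proof.
split=> [mf i j _ A mA|mf].
- apply: (mf measurableT ((fun M : 'M[T]_(m, n) => M i j) @^-1` A)).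
  by apply: sub_sigma_algebra; exists (i, j) => //; exists A => //; rewrite setTI.
- apply: measurability; first reflexivity.
  move=> _ [_ [[i j] _ [A mA <-]] <-]; rewrite !setTI.
  by have := mf i j measurableT A mA; rewrite setTI.
Qed.

End mx_measurable.

Section complex_measurable_fun.
Context d (T : measurableType d) (R : realType).
Implicit Types f g : T -> R[i].

Lemma measurable_fun_addc f g : measurable_fun setT f ->
  measurable_fun setT g -> measurable_fun setT (fun x => f x + g x).
Proof.
move=> /measurable_fun_complexP[fr fi] /measurable_fun_complexP[gr gi].
apply/measurable_fun_complexP; split.
- rewrite (_ : (fun _ => _) =
    (fun x => complex.Re (f x) + complex.Re (g x))).
    exact: measurable_funD.
  by apply/funext => x; case: (f x) (g x) => ? ? [].
- rewrite (_ : (fun _ => _) =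
    (fun x => complex.Im (f x) + complex.Im (g x))).
    exact: measurable_funD.
  by apply/funext => x; case: (f x) (g x) => ? ? [].
Qed.

Lemma measurable_fun_mulc f g : measurable_fun setT f ->
  measurable_fun setT g -> measurable_fun setT (fun x => f x * g x).
Proof.
move=> /measurable_fun_complexP[fr fi] /measurable_fun_complexP[gr gi].
apply/measurable_fun_complexP; split.
- rewrite (_ : (fun _ => _) = (fun x =>
      complex.Re (f x) * complex.Re (g x) - complex.Im (f x) * complex.Im (g x))).
    by apply: measurable_funB; exact: measurable_funM.
  by apply/funext => x; case: (f x) (g x) => ? ? [].
- rewrite (_ : (fun _ => _) = (fun x =>
      complex.Re (f x) * complex.Im (g x) + complex.Im (f x) * complex.Re (g x))).
    by apply: measurable_funD; exact: measurable_funM.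
  by apply/funext => x; case: (f x) (g x) => ? ? [].
Qed.

Lemma measurable_fun_sumc (I : finType) (h : I -> T -> R[i]) :
  (forall i, measurable_fun setT (h i)) ->
  measurable_fun setT (fun x => \sum_i h i x).
Proof.
move=> mh; elim: (index_enum I) => [|i s IHs].
  by under eq_fun do rewrite big_nil; exact: measurable_cst.
by under eq_fun do rewrite big_cons; exact: measurable_fun_addc.
Qed.

Lemma measurable_fun_mulmx (m n p : nat)
    (A : T -> 'M[R[i]]_(m, n)) (B : T -> 'M[R[i]]_(n, p)) :
  measurable_fun setT A -> measurable_fun setT B ->
  measurable_fun setT (fun x => A x *m B x).
Proof.
move=> /measurable_fun_mxP mA /measurable_fun_mxP mB.
apply/measurable_fun_mxP => i j; under eq_fun do rewrite mxE.
by apply: measurable_fun_sumc => k; exact: measurable_fun_mulc.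
Qed.

Lemma measurable_fun_addmx (m n : nat) (A B : T -> 'M[R[i]]_(m, n)) :
  measurable_fun setT A -> measurable_fun setT B ->
  measurable_fun setT (fun x => A x + B x).
Proof.
move=> /measurable_fun_mxP mA /measurable_fun_mxP mB.
apply/measurable_fun_mxP => i j; under eq_fun do rewrite mxE.
exact: measurable_fun_addc.
Qed.

End complex_measurable_fun.

Section information.
Context d (T : measurableType d) (R : realType).

Definition log2 (x : R) : R := ln x / ln 2.

(* Relative entropy in bits.  The Radon-Nikodym density dP/dQ vanishes only on
   a P-null set, so the library convention ln 0 = 0 plays no role. *)
Definition kl_divergence (P Q : probability T R) : \bar R :=
  if `[< P `<< Q >]
  then (\int[P]_x (log2 (fine (Radon_Nikodym_SigmaFinite.f P Q x)))%:E)%E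
  else +oo%E.

Context d1 (T1 : measurableType d1) d2 (T2 : measurableType d2).

Definition pair_fun (X : {mfun T >-> T1}) (Y : {mfun T >-> T2}) (w : T) :
  T1 * T2 := (X w, Y w).

HB.instance Definition _ (X : {mfun T >-> T1}) (Y : {mfun T >-> T2}) :=
  isMeasurableFun.Build _ _ T (T1 * T2)%type (pair_fun X Y)
    (measurable_fun_pair (measurable_funPT X) (measurable_funPT Y)).

End information.

Definition mutual_information d (T : measurableType d) (R : realType)
    (P : probability T R) d1 (T1 : measurableType d1)
    d2 (T2 : measurableType d2)
    (X : {RV P >-> T1}) (Y : {RV P >-> T2}) : \bar R :=
  kl_divergence (distribution P (pair_fun X Y))
                (distribution P X \x distribution P Y)%E.

Section model.
Context d (T : measurableType d) (R : realType) (P : probability T R).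

(* Mutual independence of finitely many families of events: the product rule
   over every subfamily. *)
Definition mutually_independent (I : finType) (F : I -> set (set T)) : Prop :=
  forall (J : {set I}) (E : I -> set T),
    (forall i, i \in J -> F i (E i)) ->
    P (\bigcap_(i in [set i | i \in J]) E i) = (\prod_(i in J) P (E i))%E.

Definition has_law d' (T' : measurableType d') (X : T -> T')
    (mu : set T' -> \bar R) : Prop :=
  forall A, measurable A -> P (X @^-1` A) = mu A.

(* CN(0, v) for v > 0: independent N(0, v / 2) real and imaginary parts.  The
   second parameter of normal_prob is the standard deviation. *)
Definition complex_normal (v : R) : set R[i] -> \bar R :=
  fun A => (normal_prob 0 (Num.sqrt (v / 2)) \x
            normal_prob 0 (Num.sqrt (v / 2)))%E
             [set xy : R * R | A (xy.1 +i* xy.2)].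

Definition iid_complex_normal (m n : nat) (A : T -> 'M[R[i]]_(m, n)) (v : R) :
    Prop :=
  (forall i j, has_law (fun w => A w i j) (complex_normal v)) /\
  mutually_independent (fun ij : 'I_m * 'I_n =>
    g_sigma_algebra_preimage (fun w => A w ij.1 ij.2)).

Definition independent3 d1 (T1 : measurableType d1) d2 (T2 : measurableType d2)
    d3 (T3 : measurableType d3) (X : T -> T1) (Y : T -> T2) (Z : T -> T3) :
    Prop :=
  mutually_independent (tnth [tuple g_sigma_algebra_preimage X;
    g_sigma_algebra_preimage Y; g_sigma_algebra_preimage Z]).

(* Only meaningful for integrable f (fine maps infinite values to 0). *)
Definition cexpectation (f : T -> R[i]) : R[i] :=
  fine 'E_P[fun w => complex.Re (f w)] +i*
  fine 'E_P[fun w => complex.Im (f w)].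

Definition mxexpectation (m n : nat) (A : T -> 'M[R[i]]_(m, n)) :
    'M[R[i]]_(m, n) :=
  \matrix_(i, j) cexpectation (fun w => A w i j).

Definition channel_output (m n p : nat) (H : {mfun T >-> 'M[R[i]]_(m, n)})
    (X : {mfun T >-> 'M[R[i]]_(n, p)}) (Z : {mfun T >-> 'M[R[i]]_(m, p)})
    (w : T) : 'M[R[i]]_(m, p) := H w *m X w + Z w.

HB.instance Definition _ (m n p : nat) (H : {mfun T >-> 'M[R[i]]_(m, n)})
    (X : {mfun T >-> 'M[R[i]]_(n, p)}) (Z : {mfun T >-> 'M[R[i]]_(m, p)}) :=
  isMeasurableFun.Build _ _ T 'M[R[i]]_(m, p) (channel_output H X Z)
    (measurable_fun_addmx
      (measurable_fun_mulmx (measurable_funPT H) (measurable_funPT X))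
      (measurable_funPT Z)).

(* sqrt (M n) u xi e_1^T; the first basis vector e_1 has index 0 in 'I_n. *)
Definition flash_waveform (M n : nat) (u : 'cV[R[i]]_M) (xi : {mfun T >-> R[i]})
    (w : T) : 'M[R[i]]_(M, n) :=
  ((Num.sqrt (M * n)%:R)%:C * xi w) *: (u *m \row_(j < n) (j == 0%N :> nat)%:R).

Let measurable_flash_waveform M n (u : 'cV[R[i]]_M) (xi : {mfun T >-> R[i]}) :
  measurable_fun setT (@flash_waveform M n u xi).
Proof.
apply/measurable_fun_mxP => i j; under eq_fun do rewrite mxE.
apply: measurable_fun_mulc; last exact: measurable_cst.
by apply: measurable_fun_mulc; [exact: measurable_cst|exact: measurable_funPT].
Qed.

HB.instance Definition _ (M n : nat) (u : 'cV[R[i]]_M)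
    (xi : {mfun T >-> R[i]}) :=
  isMeasurableFun.Build _ _ T 'M[R[i]]_(M, n) (@flash_waveform M n u xi)
    (@measurable_flash_waveform M n u xi).

End model.

Section hermitian.
Context {C : numClosedFieldType} {n : nat}.

(* The order of C is partial: 0 <= z (0 < z) entails that z is real. *)
Definition posdefmx (A : 'M[C]_n) : Prop :=
  A \is hermsymmx /\ forall x : 'cV[C]_n, x != 0 -> 0 < (x^t* *m A *m x) 0 0.

Definition possemidefmx (A : 'M[C]_n) : Prop :=
  A \is hermsymmx /\ forall x : 'cV[C]_n, 0 <= (x^t* *m A *m x) 0 0.

(* eigenvalue refers to row eigenvectors; row and column spectra coincide. *)
Definition largest_eigenvalue (A : 'M[C]_n) (a : C) : Prop :=
  eigenvalue A a /\ forall b, eigenvalue A b -> b <= a.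

End hermitian.

(* Main.v *)
(* The symbol xi is on-off: it equals sqrt(1/p) with probability p and 0
   otherwise, where p = T SNR / s and s = sqrt(ln(1 + 1/SNR)).

   Given that the symbol is off, the received matrix has the law Q of the noise;
   given that it is on, the first column has variance v (1 + s) instead of v, so
   its law has a density L = exp(h - c) with respect to Q, where h >= 0 is
   quadratic in the first column and c = N_c ln(1 + s).  In nats, the mutual
   information is therefore
     p (E[h L] - c) - E[m ln m],   m = 1 - p + p L,   E = expectation under Q,
   and E[h L] = N_c s.  The main term p N_c s is exactly N_c T SNR.  The
   correction p c is o(SNR) because s tends to infinity.  Finally
   0 <= E[m ln m] <= p E[L ln m], and ln m <= ln 2 + h^2 / (4 ln(1/p)), where
   E[h^2 L] = O(s^2) and ln(1/p) >= s^2, so this term is O(p) = o(SNR).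

   For sensing, Sigma = M T u u^*, which attains the bound
   tr(R^2 S) <= lambda^2 tr S that diagonalizing R gives for every S >= 0. *)

Require Import Defs.
From HB Require Import structures.
From mathcomp Require Import all_boot all_order all_algebra.
From mathcomp Require Import all_classical all_reals all_analysis.
From mathcomp Require Import measurable_realfun complex.
From mathcomp Require Import ring lra.
Set Implicit Arguments.
Unset Strict Implicit.
Unset Printing Implicit Defensive.
Import Order.TTheory GRing.Theory Num.Theory.
Import numFieldTopology.Exports numFieldNormedType.Exports.
Local Open Scope classical_set_scope.
Local Open Scope complex_scope.
Local Open Scope sesquilinear_scope.
Local Open Scope ring_scope.

(** * Measures given by densities and images *)

(** Independence is given as product rules for events, so laws are handled as measures whose values
    on rectangles are products. On the event that the symbol is on, the probability is restricted
    rather than conditioned: noise and channel entries stay independent, with total mass p. The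
    channel entries are then absorbed one at a time into the noise by Gaussian convolution. The
    resulting law is compared with Q through a product of scalar Gaussian density ratios, since
    measures that agree on rectangles agree.

    Moments need no further integration: an exponential moment of a Gaussian is the total mass of a
    rescaled Gaussian, and the second and fourth moments are extracted from exponential moments by
    [1 + x <= expR x].

    The choice of s answers two opposite demands. It must tend to infinity, so that ln(1 + s) is
    negligible against s; but the loss s^2 / ln(1/p) must be negligible too, that is, s =
    o(ln(1/p)). A square root of a logarithm meets both. *)

Section mdensity.
Local Open Scope ereal_scope.
Context d (T : measurableType d) (R : realType).

(** The proofs [mg] and [g0] are arguments so that the measure structure can be inferred from the
    term. *)
Definition mdensity (m : {measure set T -> \bar R}) (g : T -> R)
    (mg : measurable_fun setT g) (g0 : forall x, (0 <= g x)%R) : set T -> \bar R :=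
  fun A => \int[m]_(x in A) (g x)%:E.

Variables (m : {measure set T -> \bar R}) (g : T -> R).
Variables (mg : measurable_fun setT g) (g0 : forall x, (0 <= g x)%R).

Local Notation nu := (mdensity m mg g0).

Let mdensity0 : nu set0 = 0.
Proof. exact: integral_set0. Qed.

Let mdensity_ge0 A : 0 <= nu A.
Proof. by apply: integral_ge0 => x _; rewrite lee_fin. Qed.

Let mdensity_sigma_additive : semi_sigma_additive nu.
Proof.
move=> F mF tF mUF; rewrite /mdensity ge0_integral_bigcup//; last 2 first.
- by apply/measurable_EFinP/measurable_funTS.
- by move=> x _; rewrite lee_fin.
by apply: is_cvg_nneseries => n _ _; exact: mdensity_ge0.
Qed.

HB.instance Definition _ := isMeasure.Build _ _ _ nu
  mdensity0 mdensity_ge0 mdensity_sigma_additive.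

Import HBNNSimple.

(** Monotone convergence on both sides reduces the claim to simple functions, and linearity to
    indicators of level sets, where it is the definition of [mdensity]. *)
Lemma ge0_integral_mdensity (D : set T) (f : T -> \bar R) : measurable D ->
    measurable_fun D f -> (forall x, D x -> 0 <= f x) ->
  \int[nu]_(x in D) f x = \int[m]_(x in D) (f x * (g x)%:E).
Proof.
move=> mD mf f0; pose f_ := nnsfun_approx mD mf.
have mgE (E : set T) : measurable_fun E (EFin \o g).
  by apply/measurable_EFinP/measurable_funTS.
have f_f x : D x -> EFin \o f_ ^~ x @ \oo --> f x.
  by move=> Dx; exact: cvg_nnsfun_approx.
transitivity (limn (fun n => \int[nu]_(x in D) (f_ n x)%:E)).
  rewrite -monotone_convergence//=.
  - by apply: eq_integral => x /[!inE] xD; apply/esym/cvg_lim => //; exact: f_f.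
  - by move=> n; apply/measurable_EFinP/measurable_funTS.
  - by move=> n x _; rewrite lee_fin.
  - by move=> x _ i j ij; rewrite lee_fin; exact/lefP/nd_nnsfun_approx.
transitivity (limn (fun n => \int[m]_(x in D) ((f_ n x)%:E * (g x)%:E))); last first.
  rewrite -monotone_convergence//=.
  - apply: eq_integral => x /[!inE] xD; apply/cvg_lim => //.
    by apply: cvgeZr => //; exact: f_f.
  - move=> n; apply: emeasurable_funM; last exact: mgE.
    by apply/measurable_EFinP/measurable_funTS.
  - by move=> n x _; rewrite mule_ge0// lee_fin.
  - move=> x _ i j ij; rewrite lee_wpmul2r// ?lee_fin//.
    by exact/lefP/nd_nnsfun_approx.
congr (limn _); apply/funext => n.
have mpre r : measurable (f_ n @^-1` [set r]).
  by rewrite -[X in measurable X]setTI; exact: measurable_funP.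
transitivity (\int[nu]_(x in D)
    \sum_(r \in range (f_ n)) (r * \1_(f_ n @^-1` [set r]) x)%:E).
  by apply: eq_integral => x _; rewrite fimfunE -fsumEFin.
transitivity (\int[m]_(x in D)
    \sum_(r \in range (f_ n)) ((r * \1_(f_ n @^-1` [set r]) x)%:E * (g x)%:E));
  last first.
  apply: eq_integral => x _.
  rewrite -ge0_mule_fsuml; last by move=> r; exact: nnfun_muleindic_ge0.
  by rewrite fsumEFin// -fimfunE.
rewrite ge0_integral_fsum//; last 2 first.
- by move=> r; apply/measurable_EFinP/measurable_funTS/measurable_funM.
- by move=> r x _; exact: nnfun_muleindic_ge0.
rewrite ge0_integral_fsum//; last 2 first.
- move=> r; apply: emeasurable_funM; last exact: mgE.
  by apply/measurable_EFinP/measurable_funTS/measurable_funM.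
- by move=> r x _; rewrite mule_ge0 ?lee_fin//; exact: nnfun_muleindic_ge0.
apply: eq_fsbigr => r /[!inE] -[t _ <-].
rewrite integralZl_indic_nnsfun// integral_indic//.
under [RHS]eq_integral do rewrite EFinM -muleA.
rewrite ge0_integralZl//; last 3 first.
- by apply: emeasurable_funM; [apply/measurable_EFinP/measurable_funTS|exact: mgE].
- by move=> x _; rewrite mule_ge0 ?lee_fin.
- by rewrite lee_fin.
congr *%E; rewrite /= /mdensity setIC integral_mkcondr; apply: eq_integral => x _.
by rewrite epatch_indic muleC.
Qed.

End mdensity.

Section mdensity_theory.
Local Open Scope ereal_scope.
Context d (T : measurableType d) (R : realType).
Implicit Types (m nu : {measure set T -> \bar R}).

Lemma ge0_integral_density m nu (g : T -> R) (D : set T) (f : T -> \bar R) :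
    measurable_fun setT g -> (forall x, (0 <= g x)%R) ->
    (forall A, measurable A -> nu A = \int[m]_(x in A) (g x)%:E) ->
    measurable D -> measurable_fun D f -> (forall x, D x -> 0 <= f x) ->
  \int[nu]_(x in D) f x = \int[m]_(x in D) (f x * (g x)%:E).
Proof.
move=> mg g0 nuE mD mf f0; rewrite -(ge0_integral_mdensity m mg g0)//.
by apply: eq_measure_integral => A mA _; rewrite nuE.
Qed.

Lemma ge0_integral_mrestr m (B : set T) (mB : measurable B) (D : set T)
    (f : T -> \bar R) :
    measurable D -> measurable_fun D f -> (forall x, D x -> 0 <= f x) ->
  \int[mrestr m mB]_(x in D) f x = \int[m]_(x in D `&` B) f x.
Proof.
move=> mD mf f0.
rewrite [LHS](@ge0_integral_density m _ (\1_B : T -> R))//; last first.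
  by move=> A mA; rewrite integral_indic// setIC.
rewrite integral_mkcondr; apply: eq_integral => x _.
by rewrite epatch_indic.
Qed.

End mdensity_theory.

Section image_measure.
Local Open Scope ereal_scope.
Context d1 d2 (T1 : measurableType d1) (T2 : measurableType d2) (R : realType).

(** A copy of [pushforward] that carries the measurability proof, for the same reason as in
    [mdensity]. *)
Definition image_measure (m : {measure set T1 -> \bar R}) (f : T1 -> T2)
  (mf : measurable_fun setT f) : set T2 -> \bar R := pushforward m f.

Variables (m : {measure set T1 -> \bar R}) (f : T1 -> T2).
Variable mf : measurable_fun setT f.

Let image_measure0 : image_measure m mf set0 = 0.
Proof. by rewrite /image_measure /pushforward preimage_set0 measure0. Qed.

Let image_measure_ge0 A : 0 <= image_measure m mf A.
Proof. exact: measure_ge0. Qed.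

Let image_measure_sigma_additive : semi_sigma_additive (image_measure m mf).
Proof. exact: (@measure_semi_sigma_additive _ _ _ (pushforward m f)). Qed.

HB.instance Definition _ := isMeasure.Build _ _ _ (image_measure m mf)
  image_measure0 image_measure_ge0 image_measure_sigma_additive.

End image_measure.

Lemma ge0_integral_image d1 d2 (T1 : measurableType d1) (T2 : measurableType d2)
    (R : realType) (m : {measure set T1 -> \bar R})
    (nu : {measure set T2 -> \bar R}) (f : T1 -> T2) (g : T2 -> \bar R) :
    measurable_fun setT f ->
    (forall A, measurable A -> nu A = m (f @^-1` A)) ->
    measurable_fun setT g -> (forall x, 0 <= g x)%E ->
  (\int[nu]_y g y = \int[m]_x g (f x))%E.
Proof.
move=> mf nuE mg g0; transitivity (\int[image_measure m mf]_y g y)%E.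
  by apply: eq_measure_integral => A mA _; rewrite nuE.
by rewrite ge0_integral_pushforward.
Qed.

(** * Circularly symmetric complex Gaussian laws *)

Section complex_normal_measure.
Context {R : realType}.

Lemma measurable_mkcomplex :
  measurable_fun setT (fun z : R * R => z.1 +i* z.2).
Proof.
apply/measurable_fun_complexP; split => /=; [exact: measurable_fst|exact: measurable_snd].
Qed.

Lemma complex_normalE v (A : set R[i]) : complex_normal v A =
  pushforward (normal_prob 0 (Num.sqrt (v / 2)) \x
    normal_prob 0 (Num.sqrt (v / 2)))%E (fun z : R * R => z.1 +i* z.2) A.
Proof. by []. Qed.

Variable v : R.

Let complex_normal0 : complex_normal v set0 = 0%E.
Proof. by rewrite complex_normalE /pushforward preimage_set0 measure0. Qed.

Let complex_normal_ge0 A : (0 <= complex_normal v A)%E.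
Proof. by rewrite complex_normalE /pushforward measure_ge0. Qed.

Let complex_normal_sigma_additive : semi_sigma_additive (complex_normal v).
Proof.
have mc := measurable_mkcomplex.
exact: (@measure_semi_sigma_additive _ _ _ (pushforward
  (normal_prob 0 (Num.sqrt (v / 2)) \x normal_prob 0 (Num.sqrt (v / 2)))%E
  (fun z : R * R => z.1 +i* z.2))).
Qed.

HB.instance Definition _ := isMeasure.Build _ _ _ (complex_normal v)
  complex_normal0 complex_normal_ge0 complex_normal_sigma_additive.

Let complex_normal_setT : complex_normal v setT = 1%E.
Proof.
rewrite complex_normalE /pushforward preimage_setT -setXTT product_measure1E//.
by rewrite [X in (X * _)%E]probability_setT [X in (_ * X)%E]probability_setT mule1.
Qed.

HB.instance Definition _ := @Measure_isProbability.Build _ _ R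
  (complex_normal v) complex_normal_setT.

Lemma cnormal_subproof :
  {mu : probability R[i] R | mu = complex_normal v :> (set R[i] -> \bar R)}.
Proof. by exists (complex_normal v). Qed.

(* Sealing complex_normal keeps conversion from unfolding it down to the
   Lebesgue integrals it is made of. *)
Definition cnormal : probability R[i] R := sval cnormal_subproof.

Lemma cnormalE (A : set R[i]) : cnormal A = complex_normal v A.
Proof. by rewrite /cnormal; case: cnormal_subproof => mu /= ->. Qed.

End complex_normal_measure.

Section complex_gaussian_density.
Context {R : realType}.
Implicit Types (v w : R) (z : R * R).
Local Notation leb := (@lebesgue_measure R).

Definition gauss2 v z : R :=
  normal_pdf 0 (Num.sqrt (v / 2)) z.1 * normal_pdf 0 (Num.sqrt (v / 2)) z.2.

Lemma gauss2_ge0 v z : 0 <= gauss2 v z.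
Proof. by rewrite mulr_ge0 ?normal_pdf_ge0. Qed.

Lemma measurable_gauss2 v : measurable_fun setT (gauss2 v).
Proof.
by apply: measurable_funM; apply: measurableT_comp => //; exact: measurable_normal_pdf.
Qed.

(** The means are arbitrary because completing the square in [cnormal_convolution] produces a
    density that is not centred. *)
Lemma normal_pdf2E v (m z : R * R) : 0 < v ->
  normal_pdf m.1 (Num.sqrt (v / 2)) z.1 * normal_pdf m.2 (Num.sqrt (v / 2)) z.2 =
  (pi * v)^-1 * expR (- ((z.1 - m.1) ^+ 2 + (z.2 - m.2) ^+ 2) / v).
Proof.
move=> v0; have v20 : 0 < v / 2 by rewrite divr_gt0.
rewrite !normal_pdfE ?gt_eqF ?sqrtr_gt0//.
rewrite mulrACA /normal_peak /normal_fun -invfM -expr2 sqr_sqrtr; last first.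
  by rewrite mulrn_wge0// mulr_ge0 ?sqr_ge0 ?pi_ge0.
rewrite !sqr_sqrtr ?ltW// -expRD.
congr (_ * expR _); last by field; rewrite gt_eqF.
by congr (_^-1); field.
Qed.

Lemma gauss2E v z : 0 < v ->
  gauss2 v z = (pi * v)^-1 * expR (- (z.1 ^+ 2 + z.2 ^+ 2) / v).
Proof. by move=> v0; rewrite /gauss2 (normal_pdf2E (0, 0))//= !subr0. Qed.

Local Open Scope ereal_scope.

Lemma integral_normal_prob (m s : R) (f : R -> \bar R) :
    measurable_fun setT f -> (forall x, 0 <= f x) ->
  \int[normal_prob m s]_x f x = \int[leb]_x (f x * (normal_pdf m s x)%:E).
Proof.
move=> mf f0; rewrite (@ge0_integral_density _ _ _ leb _ (normal_pdf m s))//.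
- exact: measurable_normal_pdf.
- exact: normal_pdf_ge0.
Qed.

Let integral_complex_normal v (f : R[i] -> \bar R) :
    measurable_fun setT f -> (forall x, 0 <= f x) ->
  \int[complex_normal v]_x f x =
  \int[leb \x leb]_z (f (z.1 +i* z.2)%C * (gauss2 v z)%:E).
Proof.
move=> mf f0; have mc := @measurable_mkcomplex R.
have mfc : measurable_fun setT (fun z : R * R => f (z.1 +i* z.2)%C).
  by apply: (measurableT_comp mf).
set s := Num.sqrt (v / 2).
have mfx x : measurable_fun setT (fun y : R => f (x +i* y)%C).
  apply: (measurableT_comp mf); apply/measurable_fun_complexP; split=> //=.
have mpdf : measurable_fun setT (fun z : R => (normal_pdf 0 s z)%:E).
  by apply/measurable_EFinP; exact: measurable_normal_pdf.
transitivity (\int[pushforward (normal_prob 0 s \x normal_prob 0 s)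
    (fun z : R * R => (z.1 +i* z.2)%C)]_x f x); first by [].
rewrite ge0_integral_pushforward// preimage_setT.
rewrite [LHS](fubini_tonelli1 (m1 := normal_prob 0 s) (m2 := normal_prob 0 s)
  (f \o (fun z : R * R => (z.1 +i* z.2)%C)))//=.
rewrite /fubini_F/= integral_normal_prob//; last 2 first.
- by apply: (measurable_fun_fubini_tonelli_F (m2 := normal_prob 0 s)
    (fun z : R * R => f (z.1 +i* z.2)%C)) => //.
- by move=> x; exact: integral_ge0.
rewrite [RHS](fubini_tonelli1 (m1 := leb) (m2 := leb)
  (fun z : R * R => f (z.1 +i* z.2)%C * (gauss2 v z)%:E))/=; last 2 first.
- apply: emeasurable_funM => //; apply/measurable_EFinP; exact: measurable_gauss2.
- by move=> z; rewrite mule_ge0// lee_fin gauss2_ge0.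
apply: eq_integral => x _; rewrite /fubini_F/= integral_normal_prob//; last first.
rewrite -ge0_integralZr//=; last 3 first.
- by apply: emeasurable_funM => //; exact: mfx.
- by move=> y _; rewrite mule_ge0 ?lee_fin ?normal_pdf_ge0.
- by rewrite lee_fin normal_pdf_ge0.
by apply: eq_integral => y _; rewrite -muleA -EFinM mulrC.
Qed.

Lemma integral_cnormal v (f : R[i] -> \bar R) :
    measurable_fun setT f -> (forall x, 0 <= f x) ->
  \int[cnormal v]_x f x =
  \int[leb \x leb]_z (f (z.1 +i* z.2)%C * (gauss2 v z)%:E).
Proof.
move=> mf f0; rewrite -integral_complex_normal//.
by apply: eq_measure_integral => A mA _; exact: cnormalE.
Qed.

(** The image of the Lebesgue measure under a shift gives half-open intervals their length, hence is
    the Lebesgue measure. *)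
Lemma integral_lebesgue_shift (t : R) (f : R -> \bar R) :
    measurable_fun setT f -> (forall x, 0 <= f x) ->
  \int[leb]_x f (x + t)%R = \int[leb]_x f x.
Proof.
move=> mf f0.
have mt : measurable_fun setT (fun x : R => (x + t)%R) by exact: measurable_funD.
pose h : measurableTypeR R -> measurableTypeR R := fun x => (x + t)%R.
have mh : measurable_fun setT h by exact: mt.
apply: esym; apply: (ge0_integral_image (f := h)) => // A mA.
transitivity (image_measure leb mh A); last by [].
apply: lebesgue_measure_unique => // _ [[a b] _ <-]/=.
rewrite /image_measure /pushforward.
rewrite (_ : _ @^-1` _ = `](a - t)%R, (b - t)%R]%classic); last first.
  apply/seteqP; split=> x /=; rewrite !in_itv/=.
    by rewrite ltrBlDr lerBrDr.
  by rewrite ltrBlDr lerBrDr.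
rewrite !lebesgue_measure_itv/= !lte_fin ltrD2r -!EFinB.
by case: ifP => // _; congr EFin; ring.
Qed.

(** The exhaustion [F] is increasing, so both coordinates of a point lie in a common [F n]. *)
Lemma lebesgue2_sigma_finite : sigma_finite setT (leb \x leb).
Proof.
have /sigma_finiteP[F [FT ndF Foo]] := sigma_finiteT leb.
exists (fun n => F n `*` F n) => [|n]; last first.
  have [mF Fn] := Foo n; split; first exact: measurableX.
  by rewrite product_measure1E// lte_mul_pinfty// ge0_fin_numE.
rewrite -[LHS]setXTT FT; apply/seteqP; split=> [[x y]|[x y] [n _ []]].
  move=> [[n _ Fx] [k _ Fy]]; exists (maxn n k) => //; split => /=.
  - by move: Fx; exact/subsetPset/ndF/leq_maxl.
  - by move: Fy; exact/subsetPset/ndF/leq_maxr.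
by split; exists n.
Qed.

(* The library's sigma-finite structure on product measures is shadowed by the
   one it declares for products of probabilities. *)
Definition lebesgue2 :
    {sigma_finite_measure set (measurableTypeR R * measurableTypeR R)%type -> \bar R} :=
  HB.pack_for {sigma_finite_measure set (measurableTypeR R * measurableTypeR R)%type -> \bar R}
    (leb \x leb)
    (Measure_isSigmaFinite.Build _ _ _ (leb \x leb) lebesgue2_sigma_finite).

Lemma integral_lebesgue2_shift (t : R * R) (f : R * R -> \bar R) :
    measurable_fun setT f -> (forall x, 0 <= f x) ->
  \int[leb \x leb]_x f (x + t)%R = \int[leb \x leb]_x f x.
Proof.
move=> mf f0.
have mt : measurable_fun setT (fun x : R * R => (x + t)%R).
  apply/measurable_fun_pairP; split => /=; rewrite /comp/=.
  - by apply: measurable_funD.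
  - by apply: measurable_funD.
have mft : measurable_fun setT (fun x : R * R => f (x + t)%R) by exact: (measurableT_comp mf mt).
rewrite [LHS](fubini_tonelli1 (m1 := leb) (m2 := leb) (fun x : R * R => f (x + t)%R))//.
rewrite [RHS](fubini_tonelli1 (m1 := leb) (m2 := leb) f)//.
rewrite -[RHS](integral_lebesgue_shift t.1); last 2 first.
- exact: (measurable_fun_fubini_tonelli_F (m2 := leb) f mf f0).
- by move=> x; exact: integral_ge0.
apply: eq_integral => x _; rewrite /fubini_F/=.
rewrite -[RHS](integral_lebesgue_shift t.2)//.
exact: (measurableT_comp mf (pair1_measurable _)).
Qed.

End complex_gaussian_density.

Section complex_gaussian_calculus.
Context {R : realType}.
Implicit Types (v w : R) (c : R[i]).
Local Notation leb := (@lebesgue_measure R).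
Local Notation Re := complex.Re.
Local Notation Im := complex.Im.

Definition sqnormc (z : R[i]) : R := Re z ^+ 2 + Im z ^+ 2.

Lemma sqnormc_ge0 z : 0 <= sqnormc z.
Proof. by rewrite addr_ge0 ?sqr_ge0. Qed.

Lemma measurable_Re : measurable_fun setT (@complex.Re R).
Proof. by have /measurable_fun_complexP[] := @measurable_id _ R[i] setT. Qed.

Lemma measurable_Im : measurable_fun setT (@complex.Im R).
Proof. by have /measurable_fun_complexP[] := @measurable_id _ R[i] setT. Qed.

Lemma measurable_sqnormc : measurable_fun setT sqnormc.
Proof.
by apply: measurable_funD; apply: measurable_funX;
  [exact: measurable_Re|exact: measurable_Im].
Qed.

(** The density of CN(0, w) with respect to CN(0, v). *)
Definition gaussian_ratio v w (z : R[i]) : R :=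
  v / w * expR (sqnormc z * (v^-1 - w^-1)).

Lemma gaussian_ratio_ge0 v w z : 0 < v -> 0 < w -> 0 <= gaussian_ratio v w z.
Proof. by move=> v0 w0; rewrite mulr_ge0 ?expR_ge0// divr_ge0// ltW. Qed.

Lemma measurable_gaussian_ratio v w : measurable_fun setT (gaussian_ratio v w).
Proof.
apply: measurable_funM => //; apply: measurableT_comp => //.
by apply: measurable_funM => //; exact: measurable_sqnormc.
Qed.

Local Open Scope ereal_scope.

Lemma integral_gaussian_ratio v w (f : R[i] -> \bar R) :
    (0 < v)%R -> (0 < w)%R -> measurable_fun setT f -> (forall x, 0 <= f x) ->
  \int[cnormal v]_z (f z * (gaussian_ratio v w z)%:E) =
  \int[cnormal w]_z f z.
Proof.
move=> v0 w0 mf f0.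
have mfr : measurable_fun setT (fun z => f z * (gaussian_ratio v w z)%:E).
  apply: emeasurable_funM => //; apply/measurable_EFinP.
  exact: measurable_gaussian_ratio.
have fr0 z : 0 <= f z * (gaussian_ratio v w z)%:E.
  by rewrite mule_ge0// lee_fin gaussian_ratio_ge0.
apply: (etrans (integral_cnormal v mfr fr0)).
apply: (etrans _ (esym (integral_cnormal w mf f0))).
apply: eq_integral => -[x y] _ /=; rewrite -muleA -EFinM; congr (_ * _%:E).
rewrite !gauss2E// /gaussian_ratio /sqnormc/= mulrACA -expRD.
move: (@pi_gt0 R); move: (@pi R) => p p0.
by congr (_ * expR _)%R; field; rewrite ?gt_eqF.
Qed.

Lemma cnormal_density v w A : (0 < v)%R -> (0 < w)%R -> measurable A ->
  cnormal w A =
  \int[cnormal v]_(z in A) (gaussian_ratio v w z)%:E.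
Proof.
move=> v0 w0 mA; transitivity (\int[cnormal w]_z (\1_A z : R)%:E).
  by rewrite integral_indic// setIT.
rewrite [RHS]integral_mkcond; apply: (etrans (esym (integral_gaussian_ratio v0 w0 _ _))).
- exact/measurable_EFinP.
- by move=> z; rewrite lee_fin indicE.
- by apply: eq_integral => z _; rewrite epatch_indic muleC.
Qed.

(** Up to the factor [1 - t], the integrand is the density of CN(0, v / (1 - t)) with respect to
    CN(0, v). *)
Lemma integral_expR_sqnormc v t : (0 < v)%R -> (t < 1)%R ->
  \int[cnormal v]_z (expR (t / v * sqnormc z))%:E = ((1 - t)^-1)%:E.
Proof.
move=> v0 t1; have t10 : (0 < 1 - t)%R by rewrite subr_gt0.
have w0 : (0 < v / (1 - t))%R by rewrite divr_gt0.
transitivity (\int[cnormal (v / (1 - t))]_z ((1 - t)^-1%:E : \bar R)); last first.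
  by rewrite integral_cst// [X in _ * X]probability_setT mule1.
apply: (etrans _ (integral_gaussian_ratio v0 w0 _ _)) => //; last first.
  by move=> _; rewrite lee_fin invr_ge0 ltW.
apply: eq_integral => z _; rewrite -EFinM; congr EFin; rewrite /gaussian_ratio.
rewrite mulrA (_ : _ * (v / _) = 1)%R ?mul1r; last by field; rewrite !gt_eqF.
by congr expR; field; rewrite !gt_eqF.
Qed.

(* With a the second moment, the inequality 1 + x <= expR x and the exponential
   moments give 1 + t a / v <= (1 - t)^-1 for -1 < t < 1, whence a = v as t
   tends to 0 from either side. *)
Lemma integral_sqnormc v : (0 < v)%R ->
  \int[cnormal v]_z (sqnormc z)%:E = v%:E.
Proof.
move=> v0; set a := \int[_]_z _.
have msq := measurable_sqnormc.
have a0 : 0 <= a by apply: integral_ge0 => z _; rewrite lee_fin sqnormc_ge0.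
have intE t : measurable_fun setT (fun z => (expR (t * sqnormc z))%:E).
  by apply/measurable_EFinP/measurableT_comp => //; apply: measurable_funM.
have iZ t : (0 <= t)%R ->
    \int[cnormal v]_z ((t * sqnormc z)%:E) = t%:E * a.
  move=> t0; under eq_integral do rewrite EFinM.
  rewrite ge0_integralZl//; last by move=> z _; rewrite lee_fin sqnormc_ge0.
  exact/measurable_EFinP.
have i1 : \int[cnormal v]_z (1%:E : \bar R) = 1.
  by rewrite integral_cst// [X in _ * X]probability_setT mule1.
have mZ t : measurable_fun setT (fun z => (t * sqnormc z)%:E).
  by apply/measurable_EFinP/measurable_funM.
have ub t : (0 < t < 1)%R -> 1 + (t / v)%:E * a <= (1 - t)^-1%:E.
  move=> /andP[t0 t1].
  have tv0 : (0 <= t / v)%R by rewrite divr_ge0 ?ltW.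
  rewrite -(integral_expR_sqnormc v0 t1) -(iZ _ tv0) -i1.
  rewrite -ge0_integralD//; last first.
    by move=> z _; rewrite lee_fin mulr_ge0 ?sqnormc_ge0// divr_ge0 ?ltW.
  apply: ge0_le_integral => //.
  - by move=> z _; rewrite lee_fin addr_ge0// mulr_ge0 ?sqnormc_ge0// divr_ge0 ?ltW.
  - by apply: emeasurable_funD.
  - by move=> z _; rewrite lee_fin expR_ge1Dx.
have lb t : (0 < t < 1)%R -> 1 <= (1 + t)^-1%:E + (t / v)%:E * a.
  move=> /andP[t0 t1].
  have Nt1 : (- t < 1)%R by lra.
  rewrite -[X in (1 + X)^-1%:E]opprK -(integral_expR_sqnormc v0 Nt1).
  have tv0 : (0 <= t / v)%R by rewrite divr_ge0 ?ltW.
  rewrite -(iZ _ tv0) -[leLHS]i1.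
  rewrite -ge0_integralD//; last first.
    by move=> z _; rewrite lee_fin mulr_ge0 ?sqnormc_ge0// divr_ge0 ?ltW.
  apply: ge0_le_integral => //.
  - by apply: emeasurable_funD.
  - move=> z _; rewrite lee_fin -lerBlDr mulNr mulNr.
    exact: expR_ge1Dx.
have afin : a \is a fin_num.
  rewrite ge0_fin_numE//; have /ub : (0 < (2^-1 : R) < 1)%R by lra.
  rewrite ltey => + ; apply: contra_leN => /eqP ->.
  by rewrite gt0_muley ?lte_fin ?divr_gt0 ?invr_gt0// addey// ltry.
move: ub lb; rewrite -(fineK afin); set b := fine a => ub lb; congr EFin.
have b0 : (0 <= b)%R by rewrite fine_ge0.
have {}ub t : (0 < t < 1)%R -> (b * (1 - t) <= v)%R.
  move=> t01; have := ub t t01; rewrite -EFinM -EFinD lee_fin.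
  case/andP: t01 => t0 t1.
  have t10 : (0 < 1 - t)%R by lra.
  move=> h; have {h} : ((1 + t / v * b) * (1 - t) <= 1)%R.
    by rewrite -ler_pdivlMr// div1r.
  move=> h.
  rewrite -(ler_pM2l t0) -(@ler_pM2r _ v^-1) ?invr_gt0// mulfK ?gt_eqF//.
  rewrite (_ : _ / v = (1 + t / v * b) * (1 - t) - (1 - t))%R; last first.
    by field; rewrite gt_eqF.
  by lra.
have {}lb t : (0 < t < 1)%R -> (v <= b * (1 + t))%R.
  move=> t01; have := lb t t01; rewrite -EFinM -EFinD lee_fin.
  case/andP: t01 => t0 t1.
  have t10 : (0 < 1 + t)%R by lra.
  move=> h; have {h} : (1 + t <= 1 + t / v * b * (1 + t))%R.
    rewrite -[leLHS]mul1r -ler_pdivlMr// mulrDl mulfK ?gt_eqF//.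
    by rewrite mul1r.
  rewrite lerD2l => h.
  rewrite -(ler_pM2l t0) -(@ler_pM2r _ v^-1) ?invr_gt0// mulfK ?gt_eqF//.
  by rewrite (_ : _ / v = t / v * b * (1 + t))%R//; field; rewrite gt_eqF.
apply/eqP; rewrite eq_le; apply/andP; split; rewrite leNgt; apply/negP => h.
- have b1 : (0 < b)%R by exact: lt_trans h.
  (* For this [t], [b * (1 - t)] is the midpoint of [v] and [b], which exceeds [v]. *)
  have t01 : (0 < (b - v) / (2 * b) < 1)%R.
    by rewrite divr_gt0 ?subr_gt0 ?mulr_gt0//= ltr_pdivrMr ?mulr_gt0//; lra.
  have := ub _ t01.
  rewrite (_ : b * _ = (b + v) / 2)%R; last by field; rewrite gt_eqF.
  by lra.
- have [b1|b1] := eqVneq b 0%R.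
    have /lb : (0 < (2^-1 : R) < 1)%R by lra.
    by rewrite b1 mul0r leNgt v0.
  have {}b1 : (0 < b)%R by rewrite lt_neqAle eq_sym b1.
  (* The second argument makes [b * (1 + t)] the midpoint of [b] and [v], but may exceed 1; the
     minimum keeps [t] in range. *)
  have t01 : (0 < Num.min 2^-1 ((v - b) / (2 * b)) < 1)%R.
    rewrite lt_min invr_gt0 ltr0n divr_gt0 ?subr_gt0 ?mulr_gt0//=.
    by rewrite gt_min invf_lt1// ltr1n.
  have := lb _ t01; rewrite leNgt => /negP; apply.
  apply: (@le_lt_trans _ _ (b * (1 + (v - b) / (2 * b)))%R).
    by rewrite ler_pM2l// lerD2l ge_min lexx orbT.
  rewrite (_ : b * _ = (b + v) / 2)%R; last by field; rewrite gt_eqF.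
  by lra.
Qed.

(** Only the order [v ^+ 2] matters later. With [y = sqnormc z / (4 * v)], the bound [y <= expR y]
    gives [sqnormc z ^+ 2 <= 16 * v ^+ 2 * expR (2 * y)], and the last exponential has mean 2. *)
Lemma integral_sqr_sqnormc_le v : (0 < v)%R ->
  \int[cnormal v]_z (sqnormc z ^+ 2)%:E <= (32 * v ^+ 2)%:E.
Proof.
move=> v0; have h : ((2^-1 : R) < 1)%R by lra.
have -> : (32 * v ^+ 2)%:E =
    (16 * v ^+ 2)%:E * \int[cnormal v]_z (expR (2^-1 / v * sqnormc z))%:E.
  by rewrite integral_expR_sqnormc// -EFinM; congr EFin; field; lra.
have me : measurable_fun setT (fun z : R[i] => (expR (2^-1 / v * sqnormc z))%:E).
  apply/measurable_EFinP/measurableT_comp => //.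
  by apply: measurable_funM => //; exact: measurable_sqnormc.
rewrite -ge0_integralZl//=; last by rewrite lee_fin mulr_ge0// sqr_ge0.
apply: ge0_le_integral => //=.
- by move=> z _; rewrite lee_fin sqr_ge0.
- by apply/measurable_EFinP/measurable_funX; exact: measurable_sqnormc.
- apply/measurable_EFinP; apply: measurable_funM => //; exact/measurable_EFinP.
move=> z _; rewrite -EFinM lee_fin.
set y := (2^-1 / v * sqnormc z / 2)%R.
have -> : (2^-1 / v * sqnormc z = y *+ 2)%R.
  by rewrite /y -[RHS]mulr_natr divfK.
have -> : (sqnormc z = 4 * v * y)%R by rewrite /y; field; rewrite gt_eqF.
rewrite mulr2n expRD -expr2 (_ : (4 * v * y) ^+ 2 = 16 * v ^+ 2 * y ^+ 2)%R; last by ring.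
rewrite ler_pM2l; last by rewrite mulr_gt0// exprn_gt0.
have y0 : (0 <= y)%R.
  by rewrite divr_ge0// mulr_ge0 ?sqnormc_ge0// divr_ge0 ?ltW.
rewrite ler_sqr ?nnegrE ?expR_ge0//.
by apply: le_trans (expR_ge1Dx y); rewrite lerDr.
Qed.

Lemma addc_mulcE (b a : R * R) c : ((b.1 +i* b.2)%C + c * (a.1 +i* a.2)%C)%R =
  ((b.1 + (Re c * a.1 - Im c * a.2))%R +i*
   (b.2 + (Re c * a.2 + Im c * a.1))%R)%C.
Proof. by case: c => c1 c2; apply/eqP; rewrite eq_complex/= !eqxx. Qed.

(** Shifting the inner integral by [c * a] makes the argument of [f] the integration variable. After
    exchanging the integrals, completing the square in [a] leaves the density of variance [v + s]
    times a normal density in [a], which integrates to 1. *)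
Lemma cnormal_convolution v c (f : R[i] -> \bar R) : (0 < v)%R ->
    measurable_fun setT f -> (forall x, 0 <= f x) ->
  \int[cnormal 1]_a \int[cnormal v]_b f (b + c * a)%R =
  \int[cnormal (v + sqnormc c)]_z f z.
Proof.
move=> v0 mf f0; have mc := @measurable_mkcomplex R.
set s := sqnormc c; have s0 : (0 <= s)%R by exact: sqnormc_ge0.
have vs0 : (0 < v + s)%R by rewrite ltr_pwDl.
pose F (z : R * R) := f (z.1 +i* z.2)%C.
have mF : measurable_fun setT F by exact: (measurableT_comp mf mc).
have F0 z : 0 <= F z by exact: f0.
pose ca (a : R * R) : R * R := (Re c * a.1 - Im c * a.2, Re c * a.2 + Im c * a.1)%R.
have mca : measurable_fun setT ca.
  apply/measurable_fun_pairP; split => /=; rewrite /comp/=.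
  - by apply: measurable_funB; apply: measurable_funM.
  - by apply: measurable_funD; apply: measurable_funM.
have mg u : measurable_fun setT (EFin \o gauss2 u : R * R -> \bar R).
  by apply/measurable_EFinP; exact: measurable_gauss2.
have mshift (t : R[i]) : measurable_fun setT (fun z : R[i] => (z + t)%R).
  exact: measurable_fun_addc.
pose K (p : (R * R) * (R * R)) := F p.2 * (gauss2 v (p.2 - ca p.1)%R)%:E * (gauss2 1 p.1)%:E.
have msub : measurable_fun setT (fun p : (R * R) * (R * R) => (p.2 - ca p.1)%R).
  have /measurable_fun_pairP[mca1 mca2] := mca.
  apply/measurable_fun_pairP; split => /=; rewrite /comp/=.
  - apply: measurable_funB; first exact: (measurableT_comp measurable_fst measurable_snd).
    exact: (measurableT_comp mca1 measurable_fst).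
  - apply: measurable_funB; first exact: (measurableT_comp measurable_snd measurable_snd).
    exact: (measurableT_comp mca2 measurable_fst).
have mK : measurable_fun setT K.
  apply: emeasurable_funM; last exact: (measurableT_comp (mg 1%R) measurable_fst).
  apply: emeasurable_funM; first exact: (measurableT_comp mF measurable_snd).
  exact: (measurableT_comp (mg v) msub).
have K0 p : 0 <= K p.
  by rewrite mule_ge0 ?mule_ge0 ?lee_fin ?gauss2_ge0.
transitivity (\int[leb \x leb]_a \int[leb \x leb]_z K (a, z)).
  rewrite integral_cnormal//; last 2 first.
  - have := measurable_fun_fubini_tonelli_G (m1 := cnormal v)
      (fun p : R[i] * R[i] => f (p.1 + c * p.2)%R).
    apply => //; apply: (measurableT_comp mf); apply: measurable_fun_addc => //.
    exact: measurable_fun_mulc.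
  - by move=> a; exact: integral_ge0.
  apply: eq_integral => a _.
  rewrite integral_cnormal//; last exact: (measurableT_comp mf).
  rewrite -[RHS](integral_lebesgue2_shift (ca a)); last 2 first.
  - exact: (measurableT_comp mK (pair1_measurable a)).
  - by move=> z; exact: K0.
  have mh : measurable_fun setT (fun z : measurableTypeR R * measurableTypeR R =>
      f ((z.1 +i* z.2)%C + c * (a.1 +i* a.2)%C)%R * (gauss2 v z)%:E).
    apply: emeasurable_funM; last exact: mg.
    exact: (measurableT_comp (measurableT_comp mf (mshift _)) mc).
  have h0 (z : measurableTypeR R * measurableTypeR R) : setT z ->
      0 <= f ((z.1 +i* z.2)%C + c * (a.1 +i* a.2)%C)%R * (gauss2 v z)%:E.
    by move=> _; rewrite mule_ge0// lee_fin gauss2_ge0.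
  have g10 : 0 <= (gauss2 1 a)%:E by rewrite lee_fin gauss2_ge0.
  apply: (etrans (esym (ge0_integralZr (leb \x leb) measurableT mh h0 g10))).
  apply: eq_integral => z _; rewrite /K/= addrK; congr (_ * _ * _).
  by rewrite /F addc_mulcE.
apply: (etrans (fubini_tonelli (m1 := lebesgue2) (m2 := lebesgue2) K mK K0)).
apply: (etrans _ (esym (integral_cnormal (v + s) mf f0))).
apply: eq_integral => z _.
have mw : measurable_fun setT (fun a : R * R => (gauss2 v (z - ca a)%R * gauss2 1 a)%:E).
  rewrite (_ : (fun _ => _) = (fun a : R * R => ((EFin \o gauss2 v) (z - ca a)%R) *
     (EFin \o gauss2 1) a)) //.
  apply: emeasurable_funM; last exact: mg.
  exact: (measurableT_comp (mg v) (measurableT_comp msub (pair2_measurable z))).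
transitivity (F z * \int[leb \x leb]_a (gauss2 v (z - ca a)%R * gauss2 1 a)%:E).
  rewrite -ge0_integralZl//=; last by move=> a _; rewrite lee_fin mulr_ge0 ?gauss2_ge0.
  by apply: eq_integral => a _; rewrite /K/= -muleA -EFinM.
congr (_ * _).
(* The conditional law of [a] given the sum [z] is complex normal with variance [w] and mean conj(c)
   z / (v + s), whose real and imaginary parts are [m1] and [m2]. *)
pose w := (v / (v + s))%R; have w0 : (0 < w)%R by rewrite divr_gt0.
pose m1 := ((Re c * z.1 + Im c * z.2) / (v + s))%R.
pose m2 := ((Re c * z.2 - Im c * z.1) / (v + s))%R.
have gE a : (gauss2 v (z - ca a) * gauss2 1 a)%:E =
    (gauss2 (v + s) z)%:E * ((normal_pdf m1 (Num.sqrt (w / 2)) a.1)%:E *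
       (normal_pdf m2 (Num.sqrt (w / 2)) a.2)%:E).
  rewrite -!EFinM (normal_pdf2E (m1, m2))// !gauss2E//; congr EFin.
  rewrite ![(_ * expR _ * _)%R]mulrACA -!expRD; congr (_ * expR _)%R.
    move: (@pi_gt0 R); move: (@pi R) => p p0.
    by rewrite /w; field; rewrite ?gt_eqF.
  rewrite /m1 /m2 /w /s /sqnormc /ca/=; field.
  by rewrite gt_eqF//= -/(sqnormc c) -/s gt_eqF.
under eq_integral do rewrite gE.
have mpdf m : measurable_fun setT (fun x : R => (normal_pdf m (Num.sqrt (w / 2)) x)%:E).
  by apply/measurable_EFinP; exact: measurable_normal_pdf.
have mpp : measurable_fun setT (fun x : R * R =>
   (normal_pdf m1 (Num.sqrt (w / 2)) x.1)%:E * (normal_pdf m2 (Num.sqrt (w / 2)) x.2)%:E).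
  apply: emeasurable_funM.
  - exact: (measurableT_comp (mpdf m1) measurable_fst).
  - exact: (measurableT_comp (mpdf m2) measurable_snd).
rewrite ge0_integralZl//=; last 2 first.
- by move=> x _; rewrite mule_ge0 ?lee_fin ?normal_pdf_ge0.
- by rewrite lee_fin gauss2_ge0.
rewrite (fubini_tonelli1 (m1 := leb) (m2 := leb) (fun x : R * R =>
   (normal_pdf m1 (Num.sqrt (w / 2)) x.1)%:E * (normal_pdf m2 (Num.sqrt (w / 2)) x.2)%:E))//=;
  last by move=> x; rewrite mule_ge0 ?lee_fin ?normal_pdf_ge0.
rewrite /fubini_F/=.
transitivity ((gauss2 (v + s) z)%:E *
    \int[leb]_x ((normal_pdf m1 (Num.sqrt (w / 2)) x)%:E)); last first.
  by rewrite integral_normal_pdf mule1.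
congr (_ * _); apply: eq_integral => x _.
rewrite ge0_integralZl//=; [|exact: mpdf|by move=> y _; rewrite lee_fin normal_pdf_ge0
  |by rewrite lee_fin normal_pdf_ge0].
by rewrite integral_normal_pdf mule1.
Qed.

End complex_gaussian_calculus.

(** * Finite families of independent variables *)

Section finite_product_laws.
Local Open Scope ereal_scope.
Context {R : realType} {I : finType}.

(* C is the total mass, so that the law of V can be considered on an event. *)
Definition product_law d (T : measurableType d) d' (S : measurableType d')
    (C : {nonneg R}) (m : set T -> \bar R) (V : I -> T -> S)
    (mu : I -> probability S R) : Prop :=
  forall E : I -> set S, (forall k, measurable (E k)) ->
    m (\bigcap_k (V k @^-1` E k)) = C%:num%:E * \prod_k mu k (E k).

Lemma measurable_bigcap_preimage d (T : measurableType d) d'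
    (S : measurableType d') (V : I -> T -> S) (E : I -> set S) :
    (forall k, measurable_fun setT (V k)) -> (forall k, measurable (E k)) ->
  measurable (\bigcap_k (V k @^-1` E k)).
Proof.
move=> mV mE; apply: fin_bigcap_measurable; first exact: finite_finset.
by move=> k _; rewrite -[X in measurable X]setTI; exact: mV.
Qed.

Definition reset d' (S : measurableType d') (i : I) (A : set S) (E : I -> set S) k :=
  if k == i then A else E k.

Lemma measurable_reset d' (S : measurableType d') i (A : set S) E :
  measurable A -> (forall k, measurable (E k)) ->
  forall k, measurable (reset i A E k).
Proof. by move=> mA mE k; rewrite /reset; case: ifP. Qed.

Lemma bigcap_preimage_reset (T : Type) d' (S : measurableType d') (V : I -> T -> S)
    i (A : set S) E :
  \bigcap_k (V k @^-1` reset i A E k) =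
  V i @^-1` A `&` \bigcap_k (V k @^-1` reset i setT E k).
Proof.
apply/seteqP; split=> [x Vx|x [VA Vx] k _ /=].
  split; first by have := Vx i Logic.I; rewrite /reset/= eqxx.
  by move=> k _ /=; have := Vx k Logic.I; rewrite /reset /=; case: ifP.
by have := Vx k Logic.I; rewrite /reset /=; case: eqP => // ->.
Qed.

Lemma reset_id d' (S : measurableType d') i (E : I -> set S) :
  reset i (E i) E = E.
Proof. by apply/funext => k; rewrite /reset; case: eqP => // ->. Qed.

Lemma prod_reset d' (S : measurableType d') (mu : I -> probability S R) i A E :
  \prod_k mu k (reset i A E k) =
  mu i A * \prod_(k | k != i) mu k (E k).
Proof.
rewrite (bigD1 i)//= {1}/reset eqxx; congr (_ * _).
by apply: eq_bigr => k /negbTE ki; rewrite /reset ki.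
Qed.

(** Packages a product of probabilities as a scalar usable in [mscale]. *)
Lemma prod_probability_nonneg d' (S : measurableType d')
    (mu : I -> probability S R) (E : I -> set S) (P : pred I) :
    (forall k, measurable (E k)) ->
  exists K : {nonneg R}, \prod_(k | P k) mu k (E k) = K%:num%:E.
Proof.
move=> mE; have K0 : (0 <= fine (\prod_(k | P k) mu k (E k)))%R.
  by apply/fine_ge0/prode_ge0.
exists (NngNum K0) => /=; rewrite fineK//; apply: prode_fin_num => k _.
exact: fin_num_measure.
Qed.

(** While the other coordinates are confined to their sides of the rectangle, the law of [V i] is a
    multiple of [mu i]; weighting by [f] turns [mu i] into [mu'] and leaves the multiple
    unchanged. *)
Lemma product_law_tilt d (T : measurableType d) d' (S : measurableType d')
    (C : {nonneg R}) (m : {measure set T -> \bar R}) (V : I -> T -> S)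
    (mu : I -> probability S R) (i : I) (f : S -> R) (mu' : probability S R)
    (E : I -> set S) :
    (forall k, measurable_fun setT (V k)) -> product_law C m V mu ->
    measurable_fun setT f -> (forall x, (0 <= f x)%R) ->
    (forall A, measurable A -> mu' A = \int[mu i]_(x in A) (f x)%:E) ->
    (forall k, measurable (E k)) ->
  \int[m]_(x in \bigcap_k (V k @^-1` E k)) (f (V i x))%:E =
  C%:num%:E * \prod_k (if k == i then mu' else mu k) (E k).
Proof.
move=> mV mP mf f0 mu'E mE.
rewrite -(reset_id i E) bigcap_preimage_reset.
set D := \bigcap_k _; have mD : measurable D.
  by apply: measurable_bigcap_preimage => //; exact: measurable_reset.
have [K KE] := prod_probability_nonneg mu (fun k => k != i) mE.
have mVE A : measurable A -> measurable (V i @^-1` A).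
  by move=> mA; rewrite -[X in measurable X]setTI; exact: mV.
have mfV (A : set T) : measurable_fun A (fun x => (f (V i x))%:E).
  by apply/measurable_EFinP/measurable_funTS/(measurableT_comp mf).
have mf' (A : set S) : measurable_fun A (EFin \o f).
  by apply/measurable_EFinP/measurable_funTS.
rewrite -(ge0_integral_mrestr m mD)//; [|exact: mVE|by move=> x _; rewrite lee_fin].
transitivity (\int[image_measure (mrestr m mD) (mV i)]_(y in E i) (f y)%:E).
  by rewrite ge0_integral_pushforward// => y _; rewrite lee_fin.
have CK0 : (0 <= C%:num * K%:num)%R by rewrite mulr_ge0.
pose CK := NngNum CK0.
rewrite (eq_measure_integral (mscale CK (mu i))); last first.
  move=> A mA _; rewrite /image_measure /pushforward /= /mrestr /D.
  rewrite -bigcap_preimage_reset mP; last exact: measurable_reset.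
  by rewrite prod_reset KE /mscale/= EFinM -muleA; congr (_ * _); rewrite muleC.
rewrite ge0_integral_mscale//; last by move=> y _; rewrite lee_fin.
rewrite -mu'E// /CK/= EFinM -muleA; congr (_ * _).
rewrite (bigD1 i)//= eqxx {1}/reset eqxx muleC; congr (_ * _).
rewrite -KE; apply: eq_bigr => k /negbTE ki.
by rewrite ki /reset ki.
Qed.

(** Stated for a duplicate-free list to allow induction: the weights already treated become a
    density, under which [V] again has a product law, so that [product_law_tilt] applies to the next
    coordinate. *)
Lemma product_law_tilts d (T : measurableType d) d' (S : measurableType d')
    (C : {nonneg R}) (m : {measure set T -> \bar R}) (V : I -> T -> S)
    (mu mu' : I -> probability S R) (f : I -> S -> R) (s : seq I) :
    (forall k, measurable_fun setT (V k)) -> product_law C m V mu ->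
    (forall i, measurable_fun setT (f i)) -> (forall i x, (0 <= f i x)%R) ->
    (forall i A, measurable A -> mu' i A = \int[mu i]_(x in A) (f i x)%:E) ->
    uniq s ->
  forall E : I -> set S, (forall k, measurable (E k)) ->
  \int[m]_(x in \bigcap_k (V k @^-1` E k)) (\prod_(i <- s) f i (V i x))%:E =
  C%:num%:E * \prod_k (if k \in s then mu' k else mu k) (E k).
Proof.
move=> mV mP mf f0 mu'E; elim: s => [_|j s IH /= /andP[js us]] E mE.
  under eq_integral do rewrite big_nil.
  have mD := measurable_bigcap_preimage mV mE.
  by rewrite integral_cst// mul1e; exact: mP.
pose h x := (\prod_(i <- s) f i (V i x))%R.
have mh : measurable_fun setT h.
  rewrite /h; elim: (s) => [|i s' IHs].
    by under eq_fun do rewrite big_nil; exact: measurable_cst.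
  under eq_fun do rewrite big_cons.
  by apply: measurable_funM => //; exact: (measurableT_comp (mf i)).
have h0 x : (0 <= h x)%R by apply: prodr_ge0 => i _.
have Ph : product_law C (mdensity m mh h0) V
    (fun k => if k \in s then mu' k else mu k).
  by move=> F mF; exact: IH.
have := product_law_tilt (i := j) (mu' := mu' j) mV Ph (mf j) (f0 j) _ mE.
rewrite (negbTE js) => /(_ (mu'E j)).
have mD := measurable_bigcap_preimage mV mE.
have mfD : measurable_fun (\bigcap_k (V k @^-1` E k)) (fun x => (f j (V j x))%:E).
  by apply/measurable_EFinP/measurable_funTS/(measurableT_comp (mf j)).
rewrite ge0_integral_mdensity//; last by move=> x _; rewrite lee_fin.
under [X in _ -> X = _]eq_integral do rewrite big_cons EFinM.
move=> ->; congr (_ * _); apply: eq_bigr => k _.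
by rewrite in_cons; case: eqP => // ->.
Qed.

End finite_product_laws.

Section product_law_unique.
Local Open Scope ereal_scope.
Context {R : realType}.

(** Rectangles are stable under intersection and generate the sigma-algebra of matrices, and the
    total mass is finite. *)
Lemma product_law_mx_unique d (S : measurableType d) (a b : nat)
    (C : {nonneg R}) (m1 m2 : {measure set 'M[S]_(a, b) -> \bar R})
    (mu : 'I_a * 'I_b -> probability S R) :
    product_law C m1 (fun k (A : 'M[S]_(a, b)) => A k.1 k.2) mu ->
    product_law C m2 (fun k (A : 'M[S]_(a, b)) => A k.1 k.2) mu ->
  forall A, measurable A -> m1 A = m2 A.
Proof.
move=> P1 P2.
pose V (k : 'I_a * 'I_b) (A : 'M[S]_(a, b)) := A k.1 k.2.
have mV k : measurable_fun setT (V k).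
  by have /measurable_fun_mxP := @measurable_id _ 'M[S]_(a, b) setT; exact.
pose G : set (set 'M[S]_(a, b)) := [set B | exists2 E : 'I_a * 'I_b -> set S,
  (forall k, measurable (E k)) & B = \bigcap_k (V k @^-1` E k)].
have GT : G setT.
  exists (fun _ => setT) => //; apply/seteqP; split=> // x _ k _ //.
apply: (measure_unique G (fun=> setT)) => //.
- apply/seteqP; split.
    apply: smallest_sub; first exact: smallest_sigma_algebra.
    move=> _ [k _ [A mA <-]]; rewrite setTI; apply: sub_sigma_algebra.
    exists (reset k A (fun _ => setT)); first exact: measurable_reset.
    rewrite (bigcap_preimage_reset V) (_ : \bigcap_k _ = setT) ?setIT//.
    by apply/seteqP; split=> // x _ l _; rewrite /reset /=; case: ifP.
  apply: smallest_sub; first exact: sigma_algebra_measurable.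
  by move=> _ [E mE ->]; exact: measurable_bigcap_preimage.
- move=> _ _ [E mE ->] [F mF ->]; exists (fun k => E k `&` F k).
    by move=> k; exact: measurableI.
  by rewrite -bigcapI; apply: eq_bigcapr => k _; rewrite preimage_setI.
- by rewrite bigcup_const//; exists 0%N.
- by move=> _ [E mE ->]; rewrite P1// P2.
- move=> _; rewrite (_ : setT = \bigcap_k (V k @^-1` (setT : set S))); last first.
    by apply/seteqP; split=> // x _ k _.
  rewrite P1//; have [K ->] := prod_probability_nonneg mu xpredT (fun=> measurableT).
  by rewrite -EFinM ltry.
Qed.

Lemma scaled_product_measure_unique d1 d2 (S1 : measurableType d1)
    (S2 : measurableType d2) (C : {nonneg R}) (m : {measure set (S1 * S2) -> \bar R})
    (m1 : probability S1 R) (m2 : probability S2 R) :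
    (forall A B, measurable A -> measurable B ->
      m (A `*` B) = C%:num%:E * (m1 A * m2 B)) ->
  forall X, measurable X -> m X = C%:num%:E * (m1 \x m2) X.
Proof.
move=> mE; pose G := [set A `*` B | A in [set A : set S1 | measurable A] &
  B in [set B : set S2 | measurable B]].
have GT : G setT.
  exists setT; first exact: measurableT.
  by exists setT; [exact: measurableT|rewrite setXTT].
move=> X mX.
apply: (@measure_unique _ R (S1 * S2)%type G (fun=> setT) _ _ _ _ m
  (mscale C (m1 \x m2))) => //.
- by rewrite measurable_prod_measurableType.
- move=> _ _ [A mA [B mB <-]] [A' mA' [B' mB' <-]]; exists (A `&` A').
    exact: measurableI.
  by exists (B `&` B'); [exact: measurableI|rewrite setXI].
- by rewrite bigcup_const//; exists 0%N.
- move=> _ [A mA [B mB <-]]; rewrite mE//.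
  transitivity (C%:num%:E * (m1 \x m2) (A `*` B)); last by [].
  by rewrite product_measure1E.
- by move=> _; rewrite -setXTT mE// !probability_setT !mule1 ltry.
Qed.

End product_law_unique.

(** * Absorbing the channel entries into the noise *)

Section gaussian_merge.
Local Open Scope ereal_scope.
Context {R : realType}.

Lemma cnormal_convolution_set (v : R) (c : R[i]) (A : set R[i]) :
    (0 < v)%R -> measurable A ->
  (cnormal v \x cnormal 1) [set p | A (p.1 + c * p.2)%R] =
  cnormal (v + sqnormc c) A.
Proof.
move=> v0 mA; set X := [set p | _].
have mX : measurable X.
  have mf : measurable_fun setT (fun p : R[i] * R[i] => (p.1 + c * p.2)%R).
    by apply: measurable_fun_addc => //; apply: measurable_fun_mulc.
  by rewrite -[X]setTI; exact: mf.
have mI : measurable_fun setT (EFin \o \1_A : R[i] -> \bar R).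
  exact/measurable_EFinP.
transitivity (\int[cnormal v \x cnormal 1]_p (\1_X p : R)%:E).
  by rewrite integral_indic// setIT.
rewrite (fubini_tonelli2 (m1 := cnormal v) (m2 := cnormal 1) (fun p => (\1_X p : R)%:E)).
- transitivity (\int[cnormal (v + sqnormc c)]_z (\1_A z : R)%:E).
    have I0 z : 0 <= (EFin \o \1_A : R[i] -> \bar R) z by rewrite lee_fin.
    apply: etrans (cnormal_convolution c v0 mI I0).
    by apply: eq_integral => a _; apply: eq_integral => b _.
  by rewrite integral_indic// setIT.
- exact/measurable_EFinP.
- by move=> p; rewrite lee_fin.
Qed.

Context {I : finType} d (T : measurableType d).

Definition merge_fun (V : I -> T -> R[i]) (i j : I) (c : R[i]) (k : I) : T -> R[i] :=
  if k == i then fun w => (V i w + c * V j w)%R else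
  if k == j then fun=> 0%R else V k.

Definition zero_law : probability R[i] R := \d_(0%R : R[i]).

Definition merge_law (mu : I -> probability R[i] R) (i j : I) (v : R) (k : I) :
    probability R[i] R :=
  if k == i then cnormal v else if k == j then zero_law else mu k.

(* An entry absorbed into the received signal is replaced by 0 rather than
   dropped, which keeps the index type fixed and the family independent. *)
Lemma product_law_merge (C : {nonneg R}) (m : {measure set T -> \bar R})
    (V : I -> T -> R[i]) (mu : I -> probability R[i] R) i j v c :
    i != j -> (forall k, measurable_fun setT (V k)) -> product_law C m V mu ->
    (0 < v)%R -> mu i = cnormal v -> mu j = cnormal 1 ->
  product_law C m (merge_fun V i j c) (merge_law mu i j (v + sqnormc c)).
Proof.
move=> ij mV mP v0 mui muj E mE.
have ji : j != i by rewrite eq_sym.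
(* On [D] the coordinates other than [i] and [j] lie in their sides while these two are free; there
   the pair [(V i, V j)] has a multiple of the product law [mu i \x mu j], to which the convolution
   applies. *)
pose O := reset j setT (reset i setT E).
have resetC (A B : set R[i]) : reset i A (reset j B E) = reset j B (reset i A E).
  apply/funext => k; rewrite /reset; case: (eqVneq k i) => // ->.
  by rewrite (negbTE ij).
set D := \bigcap_k (V k @^-1` O k).
have mO k : measurable (O k) by do 2 apply: measurable_reset => //.
have mD : measurable D by exact: measurable_bigcap_preimage.
have [K KE] := prod_probability_nonneg mu (fun k => (k != i) && (k != j)) mE.
have prodE (A B : set R[i]) :
    \prod_k mu k (reset i A (reset j B E) k) = mu i A * (mu j B * K%:num%:E).
  rewrite prod_reset; congr (_ * _); rewrite (bigD1 j)//= {1}/reset eqxx.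
  congr (_ * _); rewrite -KE; apply: eq_bigr => k /andP[_ /negbTE kj].
  by rewrite /reset kj.
rewrite (bigD1 i)//= (bigD1 j)//= {1 2}/merge_law eqxx (negbTE ji) eqxx.
rewrite (eq_bigr (fun k => mu k (E k))); last first.
  by move=> k /andP[/negbTE ki /negbTE kj]; rewrite /merge_law ki kj.
rewrite KE.
have setE : \bigcap_k (merge_fun V i j c k @^-1` E k) =
    [set w | E j 0%R] `&` ([set w | E i (V i w + c * V j w)%R] `&` D).
  apply/seteqP; split=> [w Vw|w [Ej [Ei Dw]] k _ /=].
    split; first by have := Vw j Logic.I; rewrite /merge_fun/= (negbTE ji) eqxx.
    split; first by have := Vw i Logic.I; rewrite /merge_fun/= eqxx.
    move=> k _ /=; rewrite /O /reset; case: eqP => // /eqP kj; case: eqP => // /eqP ki.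
    by have := Vw k Logic.I; rewrite /merge_fun/= (negbTE ki) (negbTE kj).
  rewrite /merge_fun; case: eqP => [->//|/eqP ki]; case: eqP => [->//|/eqP kj].
  by have := Dw k Logic.I; rewrite /O /reset/= (negbTE ki) (negbTE kj).
rewrite setE /= diracE.
(* The coordinate [j] is now constantly 0, so its side contributes a factor 0 or 1. *)
have [Ej|Ej] := pselect (E j 0%R); last first.
  rewrite memNset// mul0e !mule0.
  by rewrite (_ : [set w | E j 0%R] = set0) ?set0I ?measure0//; apply/seteqP; split.
rewrite mem_set// mul1e (_ : [set w | E j 0%R] = setT); last first.
  by apply/seteqP; split=> // w _.
rewrite setTI.
have mpair : measurable_fun setT (fun w => (V i w, V j w)).
  by apply/measurable_fun_pairP; split; exact: mV.
have CK0 : (0 <= C%:num * K%:num)%R by rewrite mulr_ge0.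
set X := [set p : R[i] * R[i] | E i (p.1 + c * p.2)%R].
have mX : measurable X.
  have mf : measurable_fun setT (fun p : R[i] * R[i] => (p.1 + c * p.2)%R).
    by apply: measurable_fun_addc => //; apply: measurable_fun_mulc.
  by rewrite -[X]setTI; exact: mf.
have nuE : image_measure (mrestr m mD) mpair X =
    (C%:num * K%:num)%:E * (mu i \x mu j) X.
  apply: (scaled_product_measure_unique (C := NngNum CK0)) mX => A B mA mB.
  rewrite /image_measure /pushforward /= /mrestr.
  rewrite (_ : _ `&` D = \bigcap_k (V k @^-1` reset i A (reset j B E) k)).
    rewrite mP; last by do 2 apply: measurable_reset => //.
    rewrite prodE EFinM -[RHS]muleA; congr (_ * _).
    by rewrite muleA muleC.
  rewrite bigcap_preimage_reset resetC bigcap_preimage_reset -/O -/D.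
  by rewrite setIA.
rewrite mui muj cnormal_convolution_set// in nuE.
transitivity (image_measure (mrestr m mD) mpair X); first by [].
by rewrite nuE EFinM -muleA; congr (_ * _); rewrite muleC.
Qed.

End gaussian_merge.

Section channel_law.
Local Open Scope ereal_scope.
Context {R : realType}.

Lemma product_law_inl (I J : finType) d (T : measurableType d) d'
    (S : measurableType d') (C : {nonneg R}) (m : set T -> \bar R)
    (V : I + J -> T -> S) (mu : I + J -> probability S R) :
    product_law C m V mu ->
  product_law C m (fun i => V (inl i)) (fun i => mu (inl i)).
Proof.
move=> mP E mE; pose F (k : I + J) := if k is inl i then E i else setT.
have mF k : measurable (F k) by case: k => k /=; [exact: mE|exact: measurableT].
rewrite (_ : \bigcap_k _ = \bigcap_k (V k @^-1` F k)); last first.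
  apply/seteqP; split=> [w Ew [i|j] _ //=|w Fw i _ /=]; first exact: Ew.
  by have := Fw (inl i) Logic.I.
rewrite mP//; congr (_ * _); rewrite big_sumType/= [X in _ * X]big1 ?mule1//.
by move=> j _; exact: probability_setT.
Qed.

Context d (T : measurableType d) (a b n : nat).
Variables (Z : T -> 'M[R[i]]_(a, b)) (H : T -> 'M[R[i]]_(a, n)).
Hypotheses (mZ : measurable_fun setT Z) (mH : measurable_fun setT H).
Variables (C : {nonneg R}) (m : {measure set T -> \bar R}) (v : R) (v0 : (0 < v)%R).
Variables (g : 'cV[R[i]]_n) (j0 : 'I_b).
Let I := ('I_a * 'I_b + 'I_a * 'I_n)%type.

(** An intermediate state: the entries of [H] listed in [s] have been moved into column [j0] of [Z],
    the only column that the waveform excites. [mu s] gives the matching laws. *)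
Let V (s : seq ('I_a * 'I_n)) (k : I) (w : T) : R[i] :=
  match k with
  | inl ij => (Z w ij.1 ij.2 + (if ij.2 == j0 then
      \sum_(ik <- s | ik.1 == ij.1) g ik.2 0 * H w ik.1 ik.2 else 0))%R
  | inr ik => if ik \in s then 0%R else H w ik.1 ik.2
  end.

Let mu (s : seq ('I_a * 'I_n)) (k : I) : probability R[i] R :=
  match k with
  | inl ij => cnormal (v + (if ij.2 == j0 then
      \sum_(ik <- s | ik.1 == ij.1) sqnormc (g ik.2 0) else 0))%R
  | inr ik => if ik \in s then zero_law else cnormal 1
  end.

Hypothesis mP : product_law C m
  (fun (k : I) w => match k with inl ij => Z w ij.1 ij.2 | inr ik => H w ik.1 ik.2 end)
  (fun k : I => if k is inl _ then cnormal v else cnormal 1).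

Let product_law_nil : product_law C m (V [::]) (mu [::]).
Proof.
have VE : V [::] = (fun k w =>
    match k with inl ij => Z w ij.1 ij.2 | inr ik => H w ik.1 ik.2 end).
  by apply/funext => -[ij|ik]; apply/funext => w; rewrite /V ?big_nil ?if_same ?addr0.
have muE : mu [::] = (fun k => if k is inl _ then cnormal v else cnormal 1).
  by apply/funext => -[ij|//]; rewrite /mu big_nil if_same addr0.
by rewrite VE muE; exact: mP.
Qed.

Let mV s k : measurable_fun setT (V s k).
Proof.
move: (mZ) (mH) => /measurable_fun_mxP mZ' /measurable_fun_mxP mH'.
case: k => [[i j]|[i k]]; rewrite /V /=; last by case: ((i, k) \in s) => //; exact: mH'.
apply: measurable_fun_addc; first exact: mZ'.
case: (j == j0); last exact: measurable_cst.
elim: s => [|ik s IHs].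
  by under eq_fun do rewrite big_nil; exact: measurable_cst.
under eq_fun do rewrite big_cons; case: (ik.1 == i) => //.
apply: measurable_fun_addc => //.
by apply: measurable_fun_mulc; [exact: measurable_cst|exact: mH'].
Qed.

(** Absorbing the entry [(i, k)] of [H] alters only entry [(i, j0)] of the signal, whose variance
    grows by [sqnormc (g k 0)]. Since [(i, k)] is not in [s], that entry of [H] is still standard
    Gaussian and [product_law_merge] applies. *)
Let product_law_partial s : uniq s -> product_law C m (V s) (mu s).
Proof.
elim: s => [_|[i k] s IHs /= /andP[iks us]]; first exact: product_law_nil.
have {}IHs := IHs us.
set v' := (v + \sum_(ik <- s | ik.1 == i) sqnormc (g ik.2 0))%R.
have v'0 : (0 < v')%R.
  by rewrite ltr_pwDl// sumr_ge0// => ik _; exact: sqnormc_ge0.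
have ne : inl (i, j0) != inr (i, k) :> I by [].
have := product_law_merge (g k 0%R) ne (mV s) IHs v'0.
rewrite /= eqxx (negbTE iks) => /(_ erefl erefl).
rewrite (_ : merge_fun _ _ _ _ = V ((i, k) :: s)); last first.
  apply/funext => -[[i' j']|[i' k']]; apply/funext => w; rewrite /merge_fun /=.
    rewrite big_cons/=; case: (eqVneq j' j0) => [->|jj0].
      case: (eqVneq i i') => [<-|ii'].
        by rewrite !eqxx (negbTE iks) -addrA; congr (_ + _)%R; rewrite addrC.
      rewrite ifF; first by rewrite /V /= eqxx.
      by apply/eqP => -[ii]; rewrite ii eqxx in ii'.
    rewrite ifF; first by rewrite /V /= (negbTE jj0).
    by apply/eqP => -[_ jj]; rewrite jj eqxx in jj0.
  by rewrite in_cons (inj_eq inr_inj); case: eqP.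
rewrite (_ : merge_law _ _ _ _ = mu ((i, k) :: s))//.
apply/funext => -[[i' j']|[i' k']]; rewrite /merge_law /=.
  rewrite big_cons/=; case: (eqVneq j' j0) => [->|jj0].
    case: (eqVneq i i') => [<-|ii'].
      by rewrite !eqxx /v' -addrA; congr (cnormal (_ + _)%R); rewrite addrC.
    rewrite ifF; first by rewrite /mu /= ?eqxx.
    by apply/eqP => -[ii]; rewrite ii eqxx in ii'.
  rewrite ifF; first by rewrite /mu /= ?(negbTE jj0).
  by apply/eqP => -[_ jj]; rewrite jj eqxx in jj0.
by rewrite in_cons (inj_eq inr_inj); case: eqP.
Qed.

Let sum_row (W : nmodType) (F : 'I_a * 'I_n -> W) i :
  (\sum_(ik <- enum {: 'I_a * 'I_n} | ik.1 == i) F ik = \sum_k F (i, k))%R.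
Proof.
rewrite big_enum_cond/=.
transitivity (\sum_(i' | i' == i) \sum_k F (i', k))%R; last by rewrite big_pred1_eq.
rewrite (pair_big_dep _ (fun _ _ => true) (fun i' k => F (i', k)))/=.
by apply: eq_big => [[i' k]|[i' k] _] /=; rewrite ?andbT.
Qed.

(** Once all entries of [H] are absorbed, the left summand of the index type carries the received
    matrix, and the zeros on the right are marginalized out. *)
Lemma product_law_channel :
  product_law C m
    (fun ij w => (H w *m (g *m (\row_j (j == j0)%:R)) + Z w)%R ij.1 ij.2)
    (fun ij => cnormal (v + (if ij.2 == j0 then \sum_k sqnormc (g k 0) else 0))%R).
Proof.
set s := enum {: 'I_a * 'I_n}.
have VE : (fun ij => V s (inl ij)) =
    (fun ij w => (H w *m (g *m (\row_j (j == j0)%:R)) + Z w)%R ij.1 ij.2).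
  apply/funext => -[i j]; apply/funext => w; rewrite /V /= sum_row !mxE addrC.
  congr (_ + _)%R; case: (eqVneq j j0) => [->|jj0].
    apply: eq_bigr => k _; rewrite !mxE big_ord1 !mxE eqxx mulr1.
    by rewrite mulrC.
  rewrite big1// => k _; rewrite !mxE big_ord1 !mxE (negbTE jj0).
  by rewrite !mulr0.
have muE : (fun ij => mu s (inl ij)) = (fun ij =>
    cnormal (v + (if ij.2 == j0 then \sum_k sqnormc (g k 0) else 0))%R).
  by apply/funext => -[i j]; rewrite /mu /= sum_row.
rewrite -VE -muE; apply: product_law_inl; apply: product_law_partial.
exact: enum_uniq.
Qed.

End channel_law.

(** * Mutual information of on-off keying *)

Section kl_of_density.
Local Open Scope ereal_scope.
Context d (T : measurableType d) (R : realType).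

Lemma measurable_log2 : measurable_fun setT (@log2 R).
Proof. by apply: measurable_funM => //; exact: measurable_ln. Qed.

(** The Radon-Nikodym derivative is determined up to [Q]-null sets; these are [P]-null, so it may be
    replaced by [D] under the integral. *)
Lemma kl_divergence_density (P Q : probability T R) (D : T -> R) :
    measurable_fun setT D -> (forall x, (0 <= D x)%R) ->
    (forall A, measurable A -> P A = \int[Q]_(x in A) (D x)%:E) ->
  kl_divergence P Q = \int[P]_x (log2 (D x))%:E.
Proof.
move=> mD D0 PE.
have mDE : measurable_fun setT (EFin \o D) by exact/measurable_EFinP.
have PQ : P `<< Q.
  apply/null_content_dominatesP => A mA QA; rewrite PE//.
  by apply: null_set_integral => //; exact: measurable_funTS.
rewrite /kl_divergence asboolT//.
have mf := measurable_int _ (Radon_Nikodym_SigmaFinite.f_integrable PQ).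
have fD : ae_eq P setT (Radon_Nikodym_SigmaFinite.f P Q) (EFin \o D).
  apply: (null_dominates_ae_eq measurableT PQ); apply: integral_ae_eq => //.
    exact: Radon_Nikodym_SigmaFinite.f_integrable.
  by move=> A _ mA; rewrite -Radon_Nikodym_SigmaFinite.f_integral//; exact: PE.
apply: ae_eq_integral => //.
- apply/measurable_EFinP/(measurableT_comp measurable_log2).
  exact: (measurableT_comp _ mf).
- exact/measurable_EFinP/(measurableT_comp measurable_log2).
- by apply: filterS fD => x /= fx xT; rewrite (fx xT).
Qed.

End kl_of_density.

Lemma ge0_integral_two_point d (T : measurableType d) (R : realType)
    (nu : {measure set T -> \bar R}) (a b : {nonneg R}) (x y : T) (f : T -> \bar R) :
    (forall A, measurable A ->
      nu A = a%:num%:E * \d_x A + b%:num%:E * \d_y A)%E ->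
    measurable_fun setT f -> (forall z, 0 <= f z)%E ->
  (\int[nu]_z f z = a%:num%:E * f x + b%:num%:E * f y)%E.
Proof.
move=> nuE mf f0.
rewrite (eq_measure_integral (measure_add (mscale a \d_x) (mscale b \d_y))).
  rewrite ge0_integral_measure_add// !ge0_integral_mscale//= !integral_dirac//.
  by rewrite !diracT !mul1e.
move=> A mA _; rewrite nuE//=.
by rewrite /measure_add /msum 2!big_ord_recl big_ord0/= adde0.
Qed.

Section on_off_mutual_information.
Local Open Scope ereal_scope.
Context d (T : measurableType d) (R : realType) (P : probability T R).
Context d1 (T1 : measurableType d1) d2 (T2 : measurableType d2).
Variables (X : {RV P >-> T1}) (Y : {RV P >-> T2}) (x0 x1 : T1).
Hypotheses (x01 : x0 <> x1) (mx0 : measurable [set x0]) (mx1 : measurable [set x1]).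
Variables (p : R) (p0 : (0 < p)%R) (p1 : (p < 1)%R).
Variables (Q : probability T2 R) (h : T2 -> R) (c : R).
Hypotheses (mh : measurable_fun setT h) (h0 : forall y, (0 <= h y)%R) (c0 : (0 <= c)%R).
Let L y : R := expR (h y - c).
Let m y : R := (1 - p + p * L y)%R.
Hypothesis L1 : \int[Q]_y (L y)%:E = 1.
Hypothesis PX0 : forall A, measurable A ->
  P (X @^-1` [set x0] `&` Y @^-1` A) = (1 - p)%:E * Q A.
Hypothesis PX1 : forall A, measurable A ->
  P (X @^-1` [set x1] `&` Y @^-1` A) = p%:E * \int[Q]_(y in A) (L y)%:E.

Let q0 : (0 < 1 - p)%R. Proof. by rewrite subr_gt0. Qed.

Let mL : measurable_fun setT L.
Proof. by apply: measurableT_comp => //; exact: measurable_funB. Qed.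

Let mm : measurable_fun setT m.
Proof. by apply: measurable_funD => //; exact: measurable_funM. Qed.

Let m_ge y : (1 - p <= m y)%R.
Proof. by rewrite lerDl mulr_ge0 ?expR_ge0// ltW. Qed.

Let m_gt0 y : (0 < m y)%R. Proof. exact: lt_le_trans (m_ge y). Qed.

Let mLE (A : set T2) : measurable_fun A (EFin \o L).
Proof. exact/measurable_EFinP/measurable_funTS. Qed.

(** The logarithm of the density of the joint law with respect to the product of the marginals. As
    [m] is the density of [Y] with respect to [Q], that density is [1 / m] at [x0] and [L / m] at
    [x1]. *)
Let g (xy : T1 * T2) : R := (\1_[set x1] xy.1 * (h xy.2 - c) - ln (m xy.2))%R.

Let mg : measurable_fun setT g.
Proof.
apply: measurable_funB.
  apply: measurable_funM; first exact: (measurableT_comp (measurable_indic mx1) measurable_fst).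
  by apply: measurable_funB => //; exact: (measurableT_comp mh measurable_snd).
exact: (measurableT_comp (@measurable_ln R) (measurableT_comp mm measurable_snd)).
Qed.

Let g_x0 y : g (x0, y) = (- ln (m y))%R.
Proof. by rewrite /g/= indicE memNset// mul0r sub0r. Qed.

Let g_x1 y : g (x1, y) = (h y - c - ln (m y))%R.
Proof. by rewrite /g/= indicE mem_set// mul1r. Qed.

Let expR_g_x0 y : (expR (g (x0, y)) * m y = 1)%R.
Proof. by rewrite g_x0 expRN lnK ?posrE// mulVf// gt_eqF. Qed.

Let expR_g_x1 y : (expR (g (x1, y)) * m y = L y)%R.
Proof. by rewrite g_x1 expRB lnK ?posrE// divfK// gt_eqF. Qed.

Let PXT : P (X @^-1` [set x0]) = (1 - p)%:E /\ P (X @^-1` [set x1]) = p%:E.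
Proof.
have := PX0 measurableT; have := PX1 measurableT.
by rewrite preimage_setT !setIT L1 probability_setT !mule1.
Qed.

Let mXp (x : T1) : measurable [set x] -> measurable (X @^-1` [set x]).
Proof. by move=> mx; rewrite -[X in measurable X]setTI; exact: measurable_funP. Qed.

(** The masses of the two atoms add up to 1, so [X] takes any other value with probability 0. *)
Let PX_split B : measurable B ->
  P B = P (X @^-1` [set x0] `&` B) + P (X @^-1` [set x1] `&` B).
Proof.
move=> mB; set N := ~` (X @^-1` [set x0] `|` X @^-1` [set x1]).
have mX0 := mXp mx0; have mX1 := mXp mx1.
have mU : measurable (X @^-1` [set x0] `|` X @^-1` [set x1]) by exact: measurableU.
have mN : measurable N by exact: measurableC.
have dis : [disjoint X @^-1` [set x0] & X @^-1` [set x1]]%classic.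
  by rewrite disj_set2E; apply/eqP/seteqP; split=> // w [/= -> /x01].
have PU : P (X @^-1` [set x0] `|` X @^-1` [set x1]) = 1.
  rewrite measureU//; last exact/disj_set2P.
  have [E0 E1] := PXT; rewrite [X in X + _]E0 [X in _ + X]E1.
  by rewrite -EFinD subrK.
have PN : P N = 0 by rewrite probability_setC// PU subee.
have PBN : P (N `&` B) = 0.
  apply/eqP; rewrite eq_le measure_ge0 andbT -PN.
  by apply: le_measure; rewrite ?inE//; exact: measurableI.
transitivity (P (N `&` B) + P ((X @^-1` [set x0] `|` X @^-1` [set x1]) `&` B)).
  rewrite -measureU//; [|exact: measurableI|exact: measurableI|]; last first.
    by rewrite setIACA setICl set0I.
  by rewrite -setIUl setvU setTI.
rewrite [X in X + _]PBN add0e setIUl measureU//; [exact: measurableI|exact: measurableI|].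
by rewrite setIACA (disj_set2P dis) set0I.
Qed.

Let distX A : measurable A ->
  distribution P X A = (1 - p)%:E * \d_x0 A + p%:E * \d_x1 A.
Proof.
move=> mA; have mXA : measurable (X @^-1` A).
  by rewrite -[X in measurable X]setTI; exact: measurable_funP.
have E x : P (X @^-1` [set x] `&` X @^-1` A) = P (X @^-1` [set x]) * \d_x A.
  rewrite diracE; have [xA|xA] := pselect (A x).
    rewrite mem_set// mule1; congr (P _).
    by apply/seteqP; split=> [w []//|w /= Xw]; split => //; rewrite /= Xw.
  rewrite memNset// mule0 (_ : _ `&` _ = set0) ?measure0//.
  by apply/seteqP; split=> // w [/= ->].
have [E0 E1] := PXT.
rewrite /distribution /pushforward PX_split// !E.
by congr (_ * _ + _ * _); [exact: E0|exact: E1].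
Qed.

Let distY A : measurable A ->
  distribution P Y A = \int[Q]_(y in A) (m y)%:E.
Proof.
move=> mA; have mYA : measurable (Y @^-1` A).
  by rewrite -[X in measurable X]setTI; exact: measurable_funP.
rewrite /distribution /pushforward PX_split// PX0// PX1//.
under [RHS]eq_integral do rewrite /m EFinD EFinM.
have L0 y : A y -> 0 <= (L y)%:E by rewrite lee_fin expR_ge0.
have pL0 y : A y -> 0 <= p%:E * (L y)%:E.
  by move=> Ay; rewrite mule_ge0 ?L0// lee_fin ltW.
have q0' y : A y -> 0 <= (1 - p)%:E by rewrite lee_fin ltW.
have mpL : measurable_fun A (fun y => p%:E * (L y)%:E) by exact: emeasurable_funM.
rewrite (ge0_integralD Q mA q0' _ pL0 mpL)// integral_cst// (ge0_integralZl Q mA (@mLE A) L0)//.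
by rewrite lee_fin ltW.
Qed.

Local Notation Pi := (distribution P X \x distribution P Y).

(** The density [m] of [Y] cancels the denominator in [expR g]. With [f] an indicator this
    identifies [expR g] as the density of the joint law; for general [f] it then computes integrals
    against that law. *)
Let integral_Pi (f : T1 * T2 -> \bar R) :
    measurable_fun setT f -> (forall z, 0 <= f z) ->
  \int[Pi]_z (f z * (expR (g z))%:E) =
  (1 - p)%:E * \int[Q]_y f (x0, y) + p%:E * \int[Q]_y (f (x1, y) * (L y)%:E).
Proof.
move=> mf f0; pose k z := f z * (expR (g z))%:E.
have k0 z : 0 <= k z by rewrite mule_ge0// lee_fin expR_ge0.
have mk : measurable_fun setT k.
  apply: emeasurable_funM => //; apply/measurable_EFinP.
  exact: (measurableT_comp (@measurable_expR R) mg).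
rewrite (fubini_tonelli1 (m1 := distribution P X) (m2 := distribution P Y) k)//.
have mF := measurable_fun_fubini_tonelli_F (m2 := distribution P Y) k mk k0.
set F := fubini_F _ _.
have F0 x : 0 <= F x by exact: integral_ge0.
have FE x : F x = \int[Q]_y (f (x, y) * (expR (g (x, y)) * m y)%:E).
  have mkx : measurable_fun setT (fun y => k (x, y)).
    exact: (measurableT_comp mk (pair1_measurable x)).
  have kx0 y : setT y -> 0 <= k (x, y) by [].
  apply: etrans (ge0_integral_density mm (fun y => ltW (m_gt0 y)) distY
    measurableT mkx kx0) _.
  by apply: eq_integral => y _; rewrite /k -muleA -EFinM.
rewrite (@ge0_integral_two_point _ _ _ _ (NngNum (ltW q0)) (NngNum (ltW p0)) x0 x1)//=.
rewrite !FE; congr (_ * _ + _ * _); apply: eq_integral => y _.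
- by rewrite expR_g_x0 mule1.
- by rewrite expR_g_x1.
Qed.

Local Notation J := (distribution P (pair_fun X Y)).

Let J_density A : measurable A -> J A = \int[Pi]_(z in A) (expR (g z))%:E.
Proof.
move=> mA.
have mIA : measurable_fun setT (fun z => (\1_A z : R)%:E) by exact/measurable_EFinP.
transitivity (\int[Pi]_z ((\1_A z : R)%:E * (expR (g z))%:E)); last first.
  rewrite [RHS]integral_mkcond; apply: eq_integral => z _.
  by rewrite epatch_indic muleC.
rewrite integral_Pi//.
have mpair : measurable_fun setT (pair_fun X Y) by exact: measurable_funP.
have mJA : measurable (pair_fun X Y @^-1` A).
  by rewrite -[X in measurable X]setTI; exact: mpair.
rewrite /distribution /pushforward PX_split//.
have mxs x : measurable [set y | A (x, y)].
  have := pair1_measurable x measurableT mA; rewrite setTI; exact.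
have XYE x : X @^-1` [set x] `&` pair_fun X Y @^-1` A =
    X @^-1` [set x] `&` Y @^-1` [set y | A (x, y)].
  by apply/seteqP; split=> w [/= Xw]; rewrite /pair_fun Xw.
rewrite !XYE PX0// PX1//; congr (_ * _ + _ * _).
  transitivity (\int[Q]_y (\1_[set y | A (x0, y)] y : R)%:E); last exact: eq_integral.
  by rewrite integral_indic// setIT.
by rewrite integral_mkcond; apply: eq_integral => y _; rewrite epatch_indic muleC.
Qed.

Let integral_J (f : T1 * T2 -> \bar R) :
    measurable_fun setT f -> (forall z, 0 <= f z) ->
  \int[J]_z f z =
  (1 - p)%:E * \int[Q]_y f (x0, y) + p%:E * \int[Q]_y (f (x1, y) * (L y)%:E).
Proof.
move=> mf f0; rewrite -integral_Pi//.
have meg : measurable_fun setT (fun z => expR (g z)).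
  exact: (measurableT_comp (@measurable_expR R) mg).
exact: (ge0_integral_density meg (fun z => expR_ge0 (g z)) J_density measurableT mf
  (fun z _ => f0 z)).
Qed.

Let mutual_informationE : mutual_information X Y = \int[J]_z (g z / ln 2)%:E.
Proof.
rewrite /mutual_information (@kl_divergence_density _ _ _ J Pi (fun z => expR (g z))).
- by apply: eq_integral => z _; rewrite /log2 expRK.
- exact: (measurableT_comp (@measurable_expR R) mg).
- by move=> z; exact: expR_ge0.
- exact: J_density.
Qed.

(** The formula for nonnegative functions applies to [|f|] and to [|f| + f]; since all integrals are
    finite, the difference gives it for [f]. *)
Let integralJ_signed (f : T1 * T2 -> R) : measurable_fun setT f ->
    Q.-integrable setT (fun y => (f (x0, y))%:E) ->
    Q.-integrable setT (fun y => (f (x1, y) * L y)%:E) ->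
  \int[J]_z (f z)%:E = (1 - p)%:E * \int[Q]_y (f (x0, y))%:E +
                       p%:E * \int[Q]_y (f (x1, y) * L y)%:E.
Proof.
move=> mf i0 i1.
have L0 y : (0 <= L y)%R by exact: expR_ge0.
have mabs : measurable_fun setT (fun z => `|f z|%:E).
  by apply/measurable_EFinP; exact: measurableT_comp.
have i0a : Q.-integrable setT (fun y => `|f (x0, y)|%:E) by exact: integrable_abse i0.
have i1a : Q.-integrable setT (fun y => (`|f (x1, y)| * L y)%:E).
  apply: eq_integrable (integrable_abse i1) => // y _ /=.
  by rewrite normrM (ger0_norm (L0 y)).
have absE : \int[J]_z `|f z|%:E = (1 - p)%:E * \int[Q]_y `|f (x0, y)|%:E +
    p%:E * \int[Q]_y (`|f (x1, y)| * L y)%:E.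
  rewrite (integral_J mabs); first by congr (_ + _ * _); apply: eq_integral => y _.
  by move=> z; rewrite lee_fin.
have fin0 : \int[Q]_y `|f (x0, y)|%:E \is a fin_num by exact: integrable_fin_num.
have fin1 : \int[Q]_y (`|f (x1, y)| * L y)%:E \is a fin_num by exact: integrable_fin_num.
have finJ : \int[J]_z `|f z|%:E \is a fin_num by rewrite absE fin_numD !fin_numM.
have iJ : J.-integrable setT (EFin \o f).
  apply/integrableP; split; first exact/measurable_EFinP.
  by rewrite ltey_eq finJ.
have iJa : J.-integrable setT (fun z => `|f z|%:E) by exact: integrable_abse iJ.
have sumE : \int[J]_z (`|f z| + f z)%:E = \int[J]_z `|f z|%:E + \int[J]_z (f z)%:E.
  by rewrite -integralD.
have sum_ge0 z : (0 <= `|f z| + f z)%R by rewrite -lerBlDr sub0r -normrN ler_norm.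
have msum : measurable_fun setT (fun z => (`|f z| + f z)%:E).
  by apply/measurable_EFinP/measurable_funD => //; exact: measurableT_comp.
have := integral_J msum; rewrite sumE => /(_ (fun z => sum_ge0 z)).
have -> : \int[Q]_y (`|f (x0, y)| + f (x0, y))%:E =
   \int[Q]_y `|f (x0, y)|%:E + \int[Q]_y (f (x0, y))%:E by rewrite -integralD.
have -> : \int[Q]_y ((`|f (x1, y)| + f (x1, y))%:E * (L y)%:E) =
   \int[Q]_y (`|f (x1, y)| * L y)%:E + \int[Q]_y (f (x1, y) * L y)%:E.
  by rewrite -integralD//; apply: eq_integral => y _; rewrite -EFinM mulrDl.
have fin0' : \int[Q]_y (f (x0, y))%:E \is a fin_num by exact: integrable_fin_num.
have fin1' : \int[Q]_y (f (x1, y) * L y)%:E \is a fin_num by exact: integrable_fin_num.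
have finJ' : \int[J]_z (f z)%:E \is a fin_num by exact: integrable_fin_num.
move: absE; move: finJ finJ' fin0 fin1 fin0' fin1'.
move: (\int[J]_z `|f z|%:E) (\int[J]_z (f z)%:E) (\int[Q]_y `|f (x0, y)|%:E)
  (\int[Q]_y (`|f (x1, y)| * L y)%:E) (\int[Q]_y (f (x0, y))%:E)
  (\int[Q]_y (f (x1, y) * L y)%:E).
move=> [a||] // [b||] // [a'||] // [b'||] // [c'||] // [e'||] // _ _ _ _ _ _.
by rewrite -!EFinM -!EFinD => -[->] -[?]; congr EFin; lra.
Qed.

Variables (a1 B : R).
Hypothesis ih : Q.-integrable setT (EFin \o h).
Hypothesis hL : \int[Q]_y (h y * L y)%:E = a1%:E.
Hypothesis h2L : \int[Q]_y (h y ^+ 2 * L y)%:E <= B%:E.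

Let lnm y := ln (m y).

Let mlnm : measurable_fun setT lnm.
Proof. exact: measurableT_comp. Qed.

Let lnm_ge y : (ln (1 - p) <= lnm y)%R.
Proof. by rewrite ler_ln ?posrE. Qed.

Let L_le y : (L y <= expR (h y))%R.
Proof. by rewrite /L ler_expR lerBlDr lerDl. Qed.

(** [m] is a convex combination of 1 and [L], both at most [expR (h y)]. Together with [lnm_ge] this
    makes [lnm] integrable, with and without the weight [L]. *)
Let lnm_le y : (lnm y <= h y)%R.
Proof.
rewrite -[leRHS]expRK ler_ln ?posrE ?expR_gt0//.
apply: (@le_trans _ _ ((1 - p) * expR (h y) + p * expR (h y))%R); last first.
  by rewrite -mulrDl subrK mul1r.
apply: lerD; last by rewrite ler_pM2l.
by rewrite ler_peMr ?(ltW q0)// -[leLHS]expR0 ler_expR.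
Qed.

Let integrable_ge0 (f : T2 -> R) r : measurable_fun setT f ->
  (forall y, (0 <= f y)%R) -> \int[Q]_y (f y)%:E <= r%:E ->
  Q.-integrable setT (EFin \o f).
Proof.
move=> mf f0 fr; apply/integrableP; split; first exact/measurable_EFinP.
under eq_integral do rewrite /= ger0_norm//.
by rewrite (le_lt_trans fr)// ltry.
Qed.

Let iL : Q.-integrable setT (EFin \o L).
Proof. by apply: (@integrable_ge0 _ 1) => [//|y|]; [exact: expR_ge0|rewrite L1]. Qed.

Let ihL : Q.-integrable setT (fun y => (h y * L y)%:E).
Proof.
apply: (@integrable_ge0 _ a1); first exact: measurable_funM.
  by move=> y; rewrite mulr_ge0// expR_ge0.
by rewrite hL.
Qed.

Let ih2L : Q.-integrable setT (fun y => (h y ^+ 2 * L y)%:E).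
Proof.
apply: (@integrable_ge0 _ B) => //.
  by apply: measurable_funM => //; exact: measurable_funX.
by move=> y; rewrite mulr_ge0 ?sqr_ge0// expR_ge0.
Qed.

Let abs_lnm_le y : (`|lnm y| <= h y - ln (1 - p))%R.
Proof.
have q1 : (ln (1 - p) <= 0)%R by rewrite ln_le0// gerBl ltW.
have := lnm_le y; have := lnm_ge y; have := h0 y; rewrite ler_norml.
by move=> ? ? ?; apply/andP; split; lra.
Qed.

Let ilnm : Q.-integrable setT (EFin \o lnm).
Proof.
have i : Q.-integrable setT (fun y => (h y)%:E - (ln (1 - p))%:E).
  by apply: integrableB => //; exact: finite_measure_integrable_cst.
apply: le_integrable i => //; first exact/measurable_EFinP.
move=> y _ /=; rewrite lee_fin; apply: le_trans (abs_lnm_le y) _.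
exact: ler_norm.
Qed.

Let ilnmL : Q.-integrable setT (fun y => (lnm y * L y)%:E).
Proof.
have i : Q.-integrable setT (fun y => (h y * L y)%:E - (ln (1 - p))%:E * (L y)%:E).
  by apply: integrableB => //; exact: integrableZl.
apply: le_integrable i => //; first exact/measurable_EFinP/measurable_funM.
move=> y _ /=; rewrite lee_fin normrM (ger0_norm (expR_ge0 _)) -/(L y) -mulrBl.
apply: le_trans (ler_norm _); apply: ler_wpM2r; first exact: expR_ge0.
exact: abs_lnm_le.
Qed.

(** Here [r] is the information in nats. The sign of the entropy term comes from tangent lines:
    [m ln m >= m - 1] gives the upper bound on [r], and [ln m <= m - 1] makes the unweighted part
    [(1 - p) * fine u] nonpositive in the lower one. In both cases [m - 1 = p * L - p] integrates to
    0. *)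
Lemma on_off_mutual_information_bounds : exists r : R,
  [/\ mutual_information X Y = (r / ln 2)%:E,
      (r <= p * (a1 - c))%R &
      (p * (a1 - c) - p * (ln 2 + B / (4 * - ln p)) <= r)%R].
Proof.
pose u := \int[Q]_y (lnm y)%:E; pose w := \int[Q]_y (lnm y * L y)%:E.
have ufin : u \is a fin_num by exact: integrable_fin_num.
have wfin : w \is a fin_num by exact: integrable_fin_num.
have iLc (k : R) : Q.-integrable setT (fun y => (k * L y)%:E).
  by under eq_fun do rewrite EFinM; exact: integrableZl.
have cLE (k : R) : \int[Q]_y (k * L y)%:E = k%:E.
  by under eq_integral do rewrite EFinM; rewrite integralZl// L1 mule1.
have mlE (k : R) : \int[Q]_y (k * lnm y)%:E = (k * fine u)%:E.
  by under eq_integral do rewrite EFinM; rewrite integralZl// EFinM fineK.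
have mlLE (k : R) : \int[Q]_y (k * (lnm y * L y))%:E = (k * fine w)%:E.
  by under eq_integral do rewrite EFinM; rewrite integralZl// EFinM fineK.
have ilnmZ (k : R) : Q.-integrable setT (fun y => (k * lnm y)%:E).
  by under eq_fun do rewrite EFinM; exact: integrableZl.
have ilnmLZ (k : R) : Q.-integrable setT (fun y => (k * (lnm y * L y))%:E).
  by under eq_fun do rewrite EFinM; exact: integrableZl.
have icst (k : R) : Q.-integrable setT (fun _ => k%:E) by exact: finite_measure_integrable_cst.
have cstE (k : R) : \int[Q]_y k%:E = k%:E.
  by rewrite integral_cst// [X in _ * X]probability_setT mule1.
have hLE (k : R) : \int[Q]_y (k * (h y * L y))%:E = (k * a1)%:E.
  by under eq_integral do rewrite EFinM; rewrite integralZl// hL.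
have ihLZ (k : R) : Q.-integrable setT (fun y => (k * (h y * L y))%:E).
  by under eq_fun do rewrite EFinM; exact: integrableZl.
pose l := ((ln 2)^-1)%R : R.
have g1E y : ((g (x1, y) / ln 2 * L y) =
    l * (h y * L y) + ((- (c * l)) * L y + (- l) * (lnm y * L y)))%R.
  by rewrite g_x1 /lnm -/l; ring.
have g0E y : (g (x0, y) / ln 2 = - l * lnm y)%R.
  by rewrite g_x0 /lnm -/l; ring.
have iD (f1 f2 : T2 -> R) : Q.-integrable setT (EFin \o f1) ->
    Q.-integrable setT (EFin \o f2) -> Q.-integrable setT (fun y => (f1 y + f2 y)%:E).
  by move=> i1 i2; apply: eq_integrable (integrableD measurableT i1 i2).
have intD (f1 f2 : T2 -> R) : Q.-integrable setT (EFin \o f1) ->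
    Q.-integrable setT (EFin \o f2) ->
    \int[Q]_y (f1 y + f2 y)%:E = \int[Q]_y (f1 y)%:E + \int[Q]_y (f2 y)%:E.
  by move=> i1 i2; rewrite -(integralD_EFin measurableT i1 i2); exact: eq_integral.
have plE : \int[Q]_y (p * L y - p)%:E = 0%:E.
  by rewrite (intD _ (fun=> - p)%R (iLc p) (icst _)) cLE cstE -EFinD subrr.
have ipl : Q.-integrable setT (fun y => (p * L y - p)%:E).
  by apply: (iD _ (fun=> - p)%R); [exact: iLc|exact: icst].
have lnm_le1 y : (lnm y <= p * L y - p)%R.
  have -> : (p * L y - p = m y - 1)%R by rewrite /m; ring.
  by rewrite /lnm -[X in ln X](subrKC 1); apply: le_ln1Dx; rewrite ltrBrDl subrr.
(* The subtracted term is the integral of [m ln m], split along [m = 1 - p + p * L]. *)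
exists (p * (a1 - c) - ((1 - p) * fine u + p * fine w))%R; split.
- rewrite mutual_informationE integralJ_signed.
  + under eq_integral do rewrite g0E.
    rewrite mlE; under eq_integral do rewrite g1E.
    rewrite (_ : \int[Q]_y _ = (l * a1 + (- (c * l) + - l * fine w))%:E); last first.
      have i2 := iD _ _ (iLc (- (c * l)))%R (ilnmLZ (- l))%R.
      rewrite (intD _ _ (ihLZ l) i2) (intD _ _ (iLc _) (ilnmLZ _)).
      by rewrite hLE cLE mlLE.
    by rewrite -!EFinM -EFinD; congr EFin; rewrite -/l; ring.
  + exact: measurable_funM.
  + by under eq_fun do rewrite g0E.
  + under eq_fun do rewrite g1E.
    exact: (iD _ _ (ihLZ l) (iD _ _ (iLc (- (c * l)))%R (ilnmLZ (- l))%R)).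
- rewrite gerBl -lee_fin EFinD -mlE -mlLE -(intD _ _ (ilnmZ _) (ilnmLZ _)) -plE.
  apply: le_integral => //; first exact: (iD _ _ (ilnmZ _) (ilnmLZ _)).
  move=> y _; rewrite lee_fin.
  rewrite [leRHS](_ : _ = m y * lnm y)%R; last by rewrite /m; ring.
  have -> : (p * L y - p = m y - 1)%R by rewrite /m; ring.
  rewrite -[leLHS]opprK lerNl -mulrN -lnV ?posrE//.
  rewrite -ler_pdivlMl// opprB mulrBr mulVf ?gt_eqF// mulr1.
  have := @le_ln1Dx R ((m y)^-1 - 1).
  by rewrite subrKC; apply; rewrite ltrBrDl subrr invr_gt0.
- have u_le : (fine u <= 0)%R.
    rewrite -lee_fin fineK// -plE.
    by apply: le_integral => //= y _; rewrite lee_fin.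
  have K0 : (0 < - ln p)%R by rewrite oppr_gt0 ln_lt0// p0 p1.
  have w_le : (fine w <= ln 2 + B / (4 * - ln p))%R.
    (* From 1 - p + p e^(h - c) <= 2 e^(h^2 / (4 ln (1/p))), as
       h + ln p <= h^2 / (4 ln (1/p)) by AM-GM. *)
    have lnm_le2 y : (lnm y <= ln 2 + h y ^+ 2 / (4 * - ln p))%R.
      rewrite -[X in (_ + X)%R]expRK -lnM ?posrE ?expR_gt0// ler_ln ?posrE//;
        last by rewrite mulr_gt0 ?expR_gt0.
      rewrite (_ : 2 * _ = expR (h y ^+ 2 / (4 * - ln p)) +
        expR (h y ^+ 2 / (4 * - ln p)))%R; last by ring.
      apply: lerD.
        apply: (@le_trans _ _ 1%R); first by rewrite gerBl ltW.
        rewrite -[leLHS]expR0 ler_expR divr_ge0 ?sqr_ge0// mulr_ge0// ltW//.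
      rewrite /L -{1}[p]lnK ?posrE// -expRD ler_expR.
      apply: (@le_trans _ _ (h y + ln p)%R); first by have := c0; lra.
      rewrite ler_pdivlMr ?mulr_gt0// -subr_ge0.
      rewrite (_ : _ - _ = (h y + 2 * ln p) ^+ 2)%R ?sqr_ge0//; ring.
    have B1 : \int[Q]_y ((4 * - ln p)^-1 * (h y ^+ 2 * L y))%:E <=
        ((4 * - ln p)^-1 * B)%:E.
      under eq_integral do rewrite EFinM.
      rewrite integralZl// [leRHS]EFinM lee_wpmul2l// lee_fin invr_ge0 mulr_ge0// ltW//.
    rewrite -lee_fin fineK// EFinD [X in (_ + X%:E)]mulrC.
    apply: (@le_trans _ _ (\int[Q]_y (ln 2 * L y)%:E +
      \int[Q]_y ((4 * - ln p)^-1 * (h y ^+ 2 * L y))%:E)); last first.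
      by rewrite cLE leeD2l.
    have ih2Z : Q.-integrable setT
        (fun y => ((4 * - ln p)^-1 * (h y ^+ 2 * L y))%:E).
      by under eq_fun do rewrite EFinM; exact: integrableZl.
    rewrite -(intD _ _ (iLc _) ih2Z); apply: le_integral => //; first exact: (iD _ _ (iLc _) ih2Z).
    move=> y _; rewrite lee_fin.
    rewrite (_ : _ + _ = (ln 2 + h y ^+ 2 / (4 * - ln p)) * L y)%R; last by ring.
    by apply: ler_wpM2r; rewrite ?expR_ge0.
  have : ((1 - p) * fine u <= 0)%R by rewrite pmulr_rle0.
  have := w_le; rewrite -(ler_pM2l p0); lra.
Qed.

End on_off_mutual_information.

(** * Likelihood ratio of the Gaussian channel *)

(** Cauchy-Schwarz against the constant vector, by averaging [2 x_i x_j <= x_i^2 + x_j^2] over all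
    pairs. *)
Lemma sqr_sum_le (R : realFieldType) n (x : 'I_n -> R) :
  (\sum_i x i) ^+ 2 <= n%:R * \sum_i x i ^+ 2.
Proof.
rewrite expr2 mulr_suml; under eq_bigr do rewrite mulr_sumr.
have -> : n%:R * \sum_i x i ^+ 2 = \sum_i \sum_j (x i ^+ 2 + x j ^+ 2) / 2.
  transitivity (\sum_(i < n) \sum_(j < n) x j ^+ 2 / 2 +
                \sum_(i < n) \sum_(j < n) x i ^+ 2 / 2); last first.
    rewrite -big_split; apply: eq_bigr => i _; rewrite -big_split.
    by apply: eq_bigr => j _ /=; rewrite -mulrDl addrC.
  rewrite [X in _ + X]exchange_big/= sumr_const card_ord -mulr_suml mulr_natl.
  by rewrite -mulrnDl -splitr.
apply: ler_sum => i _; apply: ler_sum => j _.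
rewrite ler_pdivlMr// -subr_ge0 (_ : _ - _ = (x i - x j) ^+ 2) ?sqr_ge0//.
by ring.
Qed.

Section gaussian_likelihood.
Local Open Scope ereal_scope.
Context {R : realType}.

Lemma product_law_marginal (I : finType) d (T : measurableType d) d'
    (S : measurableType d') (m : set T -> \bar R) (V : I -> T -> S)
    (mu : I -> probability S R) (i : I) (A : set S) :
    product_law (1%:nng)%R m V mu -> measurable A -> m (V i @^-1` A) = mu i A.
Proof.
move=> mP mA; have mE := measurable_reset i mA (fun _ : I => @measurableT _ S).
have := mP _ mE; rewrite bigcap_preimage_reset prod_reset mul1e.
rewrite [X in _ * X]big1 ?mule1; last by move=> k _; exact: probability_setT.
move=> <-; congr (m _); rewrite (_ : \bigcap_k _ = setT) ?setIT//.
by apply/seteqP; split=> // x _ k _; rewrite /reset /=; case: ifP.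
Qed.

Context {a b : nat} (j0 : 'I_b) (v w : R) (v0 : (0 < v)%R) (vw : (v <= w)%R).
Local Notation coord := (fun (k : 'I_a * 'I_b) (y : 'M[R[i]]_(a, b)) => y k.1 k.2).
Variable Q : probability 'M[R[i]]_(a, b) R.
Hypothesis QP : product_law (1%:nng)%R Q coord (fun=> cnormal v).

Let w0 : (0 < w)%R. Proof. exact: lt_le_trans vw. Qed.

Let kap : R := (v^-1 - w^-1)%R.

Let kap0 : (0 <= kap)%R.
Proof. by rewrite subr_ge0 lef_pV2. Qed.

(** The log-likelihood ratio of variance [w] against [v] in column [j0] is this exponent minus
    [likelihood_shift]. The split isolates the constant and leaves two nonnegative parts, as the
    on-off bounds require. *)
Definition likelihood_exponent (y : 'M[R[i]]_(a, b)) : R :=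
  (\sum_i sqnormc (y i j0) * (v^-1 - w^-1))%R.

Definition likelihood_shift : R := (a%:R * ln (w / v))%R.

Local Notation h := likelihood_exponent.
Local Notation c := likelihood_shift.
Let L y : R := expR (h y - c).

Let mcoord k : measurable_fun setT (coord k).
Proof.
by have /measurable_fun_mxP := @measurable_id _ 'M[R[i]]_(a, b) setT; exact.
Qed.

Lemma likelihood_exponent_ge0 y : (0 <= h y)%R.
Proof. by apply: sumr_ge0 => i _; rewrite mulr_ge0// sqnormc_ge0. Qed.

Lemma likelihood_shift_ge0 : (0 <= c)%R.
Proof. by rewrite mulr_ge0// ln_ge0// ler_pdivlMr// mul1r. Qed.

Let msq i : measurable_fun setT (fun y : 'M[R[i]]_(a, b) => sqnormc (y i j0)).
Proof. exact: (measurableT_comp measurable_sqnormc (mcoord (i, j0))). Qed.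

Lemma measurable_likelihood_exponent : measurable_fun setT h.
Proof. by apply: measurable_sum => i; exact: measurable_funM. Qed.

Let L0 y : (0 <= L y)%R. Proof. exact: expR_ge0. Qed.

Let mL : measurable_fun setT L.
Proof.
apply: measurableT_comp => //; apply: measurable_funB => //.
exact: measurable_likelihood_exponent.
Qed.

Let f (k : 'I_a * 'I_b) (z : R[i]) : R :=
  if k.2 == j0 then gaussian_ratio v w z else 1%R.

Let gaussian_ratioE z : (gaussian_ratio v w z = expR (sqnormc z * kap - ln (w / v)))%R.
Proof.
rewrite /gaussian_ratio expRB lnK ?posrE ?divr_gt0// invf_div mulrC.
by rewrite /kap.
Qed.

Let prodE (y : 'M[R[i]]_(a, b)) : (\prod_(k <- enum {: 'I_a * 'I_b}) f k (y k.1 k.2) = L y)%R.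
Proof.
rewrite big_enum/= -(pair_big xpredT xpredT (fun i j => f (i, j) (y i j)))/=.
have cE : (c = \sum_(i < a) ln (w / v))%R by rewrite sumr_const card_ord -mulr_natl.
rewrite /L cE /likelihood_exponent -sumrB expR_sum; apply: eq_bigr => i _.
rewrite (bigD1 j0)//= /f/= eqxx big1 ?mulr1 ?gaussian_ratioE//.
by move=> j /negbTE ->.
Qed.

Definition tilted_law (k : 'I_a * 'I_b) : probability R[i] R :=
  if k.2 == j0 then cnormal w else cnormal v.

(** [L] is the product over all entries of [f], which is the Gaussian ratio in column [j0] and 1
    elsewhere; so every entry is tilted on its own. *)
Lemma product_law_likelihood : product_law (1%:nng)%R (mdensity Q mL L0) coord tilted_law.
Proof.
move=> E mE; rewrite /mdensity; under eq_integral do rewrite -prodE.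
rewrite (product_law_tilts (mu' := tilted_law) (f := f) mcoord QP)//.
- by congr (_ * _); apply: eq_bigr => k _; rewrite mem_enum.
- by move=> k; rewrite /f; case: (k.2 == j0) => //; exact: measurable_gaussian_ratio.
- by move=> k z; rewrite /f; case: (k.2 == j0) => //; exact: gaussian_ratio_ge0.
- move=> k A mA; rewrite /tilted_law /f; case: (k.2 == j0).
    exact: cnormal_density.
  by rewrite integral_cst// mul1e.
- exact: enum_uniq.
Qed.

Lemma integral_likelihood : \int[Q]_y (L y)%:E = 1.
Proof.
have := @product_law_likelihood (fun=> setT) (fun=> measurableT).
rewrite (_ : \bigcap_k _ = setT); last by apply/seteqP; split=> // y _ k _.
rewrite big1 ?mule1//; last by move=> k _; exact: probability_setT.
Qed.

(** Weighting by [L] changes the law of an entry of column [j0] from CN(0, v) to CN(0, w), so the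
    moments of [h] under [L] are Gaussian moments of variance [w]. *)
Let integral_coord (F : R[i] -> R) i : measurable_fun setT F -> (forall z, (0 <= F z)%R) ->
  \int[Q]_y (F (y i j0))%:E = \int[cnormal v]_z (F z)%:E /\
  \int[Q]_y (F (y i j0) * L y)%:E = \int[cnormal w]_z (F z)%:E.
Proof.
move=> mF F0; have mFE : measurable_fun setT (EFin \o F) by exact/measurable_EFinP.
have FE0 z : 0 <= (EFin \o F) z by rewrite lee_fin.
split.
  apply/esym/(ge0_integral_image (mcoord (i, j0)) _ mFE FE0) => A mA.
  exact/esym/(product_law_marginal _ QP).
transitivity (\int[mdensity Q mL L0]_y (F (y i j0))%:E).
  have mFc := measurableT_comp mFE (mcoord (i, j0)).
  apply/esym/(etrans (ge0_integral_mdensity Q mL L0 measurableT mFc _)) => [y _|].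
    exact: FE0.
  by apply: eq_integral => y _; rewrite EFinM.
apply/esym/(ge0_integral_image (mcoord (i, j0)) _ mFE FE0) => A mA.
have := product_law_marginal (i, j0) product_law_likelihood mA.
by rewrite /tilted_law eqxx => /esym.
Qed.

Let integral_coordZ (F : R[i] -> R) i (r : R) : measurable_fun setT F ->
    (forall z, (0 <= F z)%R) -> (0 <= r)%R ->
  \int[Q]_y (r * F (y i j0))%:E = r%:E * \int[cnormal v]_z (F z)%:E /\
  \int[Q]_y (r * (F (y i j0) * L y))%:E = r%:E * \int[cnormal w]_z (F z)%:E.
Proof.
move=> mF F0 r0; have [e1 e2] := integral_coord i mF F0.
have mFc := measurableT_comp mF (mcoord (i, j0)).
split; [rewrite -[X in _ = _ * X]e1|rewrite -[X in _ = _ * X]e2];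
  under [LHS]eq_integral do rewrite EFinM.
- rewrite ge0_integralZl ?lee_fin//; first exact/measurable_EFinP.
  by move=> y _; rewrite lee_fin.
- rewrite ge0_integralZl ?lee_fin//; first exact/measurable_EFinP/measurable_funM.
  by move=> y _; rewrite lee_fin mulr_ge0.
Qed.

Lemma integrable_likelihood_exponent : Q.-integrable setT (EFin \o h).
Proof.
apply/integrableP; split; first by apply/measurable_EFinP; exact: measurable_likelihood_exponent.
under eq_integral do rewrite /= ger0_norm ?likelihood_exponent_ge0//.
under eq_integral do rewrite /likelihood_exponent -sumEFin.
rewrite ge0_integral_sum//; last 2 first.
- by move=> i; exact/measurable_EFinP/measurable_funM.
- by move=> i y _; rewrite lee_fin mulr_ge0// sqnormc_ge0.
rewrite lte_sum_pinfty// => i _; under eq_integral do rewrite mulrC.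
rewrite (integral_coordZ i measurable_sqnormc sqnormc_ge0 kap0).1 integral_sqnormc//.
by rewrite -EFinM ltry.
Qed.

Lemma integral_likelihood_exponent :
  \int[Q]_y (h y * L y)%:E = (a%:R * (w / v - 1))%:E.
Proof.
under eq_integral do rewrite /likelihood_exponent mulr_suml -sumEFin.
rewrite ge0_integral_sum//; last 2 first.
- by move=> i; apply/measurable_EFinP/measurable_funM => //; exact: measurable_funM.
- by move=> i y _; rewrite lee_fin !mulr_ge0// sqnormc_ge0.
rewrite (eq_bigr (fun=> (w / v - 1)%:E)) => [|i _]; last first.
  under eq_integral do rewrite mulrAC mulrC.
  rewrite (integral_coordZ i measurable_sqnormc sqnormc_ge0 kap0).2 integral_sqnormc//.
  by rewrite -EFinM /kap mulrBl mulVf ?gt_eqF// [(_ * w)%R]mulrC.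
by rewrite sumEFin sumr_const card_ord mulr_natl.
Qed.

(** One factor [a] comes from [sqr_sum_le], the other from summing over rows; 32 is the
    fourth-moment constant, and [kap * w = w / v - 1]. *)
Lemma integral_sqr_likelihood_exponent_le :
  \int[Q]_y (h y ^+ 2 * L y)%:E <= (32 * a%:R ^+ 2 * (w / v - 1) ^+ 2)%:E.
Proof.
have mF : measurable_fun setT (fun z : R[i] => sqnormc z ^+ 2)%R.
  by apply: measurable_funX; exact: measurable_sqnormc.
have F0 (z : R[i]) : (0 <= sqnormc z ^+ 2)%R by rewrite sqr_ge0.
have kw : (kap * w = w / v - 1)%R by rewrite mulrBl mulVf ?gt_eqF// mulrC.
apply: (@le_trans _ _ (\int[Q]_y (\sum_i
    (a%:R * kap ^+ 2 * (sqnormc (y i j0) ^+ 2 * L y))%:E))).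
  apply: ge0_le_integral => //.
  - by move=> y _; rewrite lee_fin mulr_ge0 ?sqr_ge0.
  - apply/measurable_EFinP/measurable_funM => //.
    by apply: measurable_funX; exact: measurable_likelihood_exponent.
  - apply: emeasurable_sum => i; apply/measurable_EFinP/measurable_funM => //.
    by apply: measurable_funM => //; exact: measurable_funX.
  move=> y _; rewrite sumEFin lee_fin -mulr_sumr -mulr_suml mulrA ler_wpM2r//.
  rewrite /likelihood_exponent -mulr_suml exprMn -/kap [leRHS]mulrAC ler_wpM2r ?sqr_ge0//.
  exact: sqr_sum_le.
rewrite ge0_integral_sum//; last 2 first.
- move=> i; apply/measurable_EFinP/measurable_funM => //.
  by apply: measurable_funM => //; exact: measurable_funX.
- move=> i y _; rewrite lee_fin; apply: mulr_ge0; apply: mulr_ge0;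
    by rewrite ?sqr_ge0 ?L0 ?ler0n.
apply: (@le_trans _ _ (\sum_(i < a) (a%:R * kap ^+ 2 * (32 * w ^+ 2))%:E)).
  have r0 : (0 <= a%:R * kap ^+ 2)%R by rewrite mulr_ge0 ?sqr_ge0.
  apply: lee_sum => i _; rewrite (integral_coordZ i mF F0 r0).2 [leRHS]EFinM lee_wpmul2l//.
  exact: integral_sqr_sqnormc_le.
rewrite sumEFin sumr_const card_ord lee_fin -kw -mulr_natl le_eqVlt.
by apply/orP; left; apply/eqP; ring.
Qed.

Lemma tilted_law_density (C : {nonneg R}) (m : {measure set 'M[R[i]]_(a, b) -> \bar R}) :
    product_law C m coord tilted_law ->
  forall A, measurable A -> m A = C%:num%:E * \int[Q]_(y in A) (L y)%:E.
Proof.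
move=> mP A mA; pose m2 := mscale C (mdensity Q mL L0).
have m2P : product_law C m2 coord tilted_law.
  move=> E mE; transitivity (C%:num%:E *
      mdensity Q mL L0 (\bigcap_k (coord k @^-1` E k))); first by [].
  by rewrite product_law_likelihood// mul1e.
exact: (product_law_mx_unique mP m2P).
Qed.

End gaussian_likelihood.

(** * Measurable singletons, and product laws from the independence hypotheses *)

Lemma measurable_set1_complex (R : realType) (z : R[i]) : measurable [set z].
Proof.
have mre : measurable (@complex.Re R @^-1` [set complex.Re z]).
  rewrite -[X in measurable X]setTI.
  exact: (measurable_Re measurableT (measurable_set1 _)).
have mim : measurable (@complex.Im R @^-1` [set complex.Im z]).
  rewrite -[X in measurable X]setTI.
  exact: (measurable_Im measurableT (measurable_set1 _)).
rewrite (_ : [set z] = @complex.Re R @^-1` [set complex.Re z] `&`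
    @complex.Im R @^-1` [set complex.Im z]); first exact: measurableI.
apply/seteqP; split=> [_ ->//|[x y] [/= xz yz]].
by case: z xz yz {mre mim} => ? ? /= -> ->.
Qed.

Lemma measurable_mx_rectangle d (T : measurableType d) (m n : nat)
    (E : 'I_m * 'I_n -> set T) : (forall k, measurable (E k)) ->
  measurable (\bigcap_k ((fun B : 'M[T]_(m, n) => B k.1 k.2) @^-1` E k)).
Proof.
move=> mE; apply: fin_bigcap_measurable; first exact: finite_finset.
move=> k _; rewrite -[X in measurable X]setTI.
by have /measurable_fun_mxP mid := @measurable_id _ 'M[T]_(m, n) setT; exact: mid.
Qed.

Lemma measurable_set1_mx d (T : measurableType d) (m n : nat) (A : 'M[T]_(m, n)) :
  (forall x : T, measurable [set x]) -> measurable [set A].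
Proof.
move=> m1; rewrite (_ : [set A] = \bigcap_(k : 'I_m * 'I_n)
    ((fun B : 'M[T]_(m, n) => B k.1 k.2) @^-1` [set A k.1 k.2])).
  by apply: measurable_mx_rectangle => k.
apply/seteqP; split=> [_ ->//|B BA]; apply/matrixP => i j.
exact: (BA (i, j) Logic.I).
Qed.

Section independence.
Local Open Scope ereal_scope.
Context d (T : measurableType d) (R : realType) (P : probability T R).

Lemma preimage_g_sigma_algebra d' (T' : measurableType d') (X : T -> T') (A : set T') :
  measurable A -> g_sigma_algebra_preimage X (X @^-1` A).
Proof. by move=> mA; exists A => //; rewrite setTI. Qed.

Lemma independent3P d1 (T1 : measurableType d1) d2 (T2 : measurableType d2)
    d3 (T3 : measurableType d3) (X : T -> T1) (Y : T -> T2) (Z : T -> T3) A B C :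
    independent3 P X Y Z -> measurable A -> measurable B -> measurable C ->
  P (X @^-1` A `&` Y @^-1` B `&` Z @^-1` C) =
  P (X @^-1` A) * P (Y @^-1` B) * P (Z @^-1` C).
Proof.
move=> ind mA mB mC.
pose E := tnth [tuple X @^-1` A; Y @^-1` B; Z @^-1` C].
have EP i : i \in [set: 'I_3]%SET ->
    tnth [tuple g_sigma_algebra_preimage X; g_sigma_algebra_preimage Y;
                g_sigma_algebra_preimage Z] i (E i).
  move=> _; case: i => -[|[|[|//]]] i; rewrite /E !(tnth_nth set0)/=;
    exact: preimage_g_sigma_algebra.
have := ind [set: 'I_3]%SET E EP.
rewrite (eq_bigl xpredT); last by move=> i; exact: finset.in_setT.
rewrite !big_ord_recl big_ord0 mule1 /E !(tnth_nth set0)/= muleA => <-.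
congr (P _); apply/seteqP; split=> [w [[Xw Yw] Zw] i _|w Ew].
  by case: i => -[|[|[|//]]] i; rewrite (tnth_nth set0).
split; first split.
- by have := Ew (@Ordinal 3 0 isT); rewrite (tnth_nth set0)/=; apply; rewrite inE.
- by have := Ew (@Ordinal 3 1 isT); rewrite (tnth_nth set0)/=; apply; rewrite inE.
- by have := Ew (@Ordinal 3 2 isT); rewrite (tnth_nth set0)/=; apply; rewrite inE.
Qed.

Lemma iid_complex_normal_law (m n : nat) (A : T -> 'M[R[i]]_(m, n)) v :
    iid_complex_normal P A v ->
  product_law (1%:nng)%R P (fun k w => A w k.1 k.2) (fun=> cnormal v).
Proof.
move=> [lawA indA] E mE; rewrite mul1e.
have := indA [set: 'I_m * 'I_n]%SET (fun k => (fun w => A w k.1 k.2) @^-1` E k).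
rewrite (_ : [set i | i \in [set: 'I_m * 'I_n]%SET] = setT); last first.
  by apply/seteqP; split=> // i _ /=; exact: finset.in_setT.
move=> ->; last by move=> k _; exact: preimage_g_sigma_algebra.
apply: eq_big => [k|[i j] _]; first exact: finset.in_setT.
by rewrite cnormalE; exact: lawA.
Qed.

End independence.

(** * The Gaussian channel driven by a two-valued symbol *)

Section flash_channel.
Local Open Scope ereal_scope.
Context (R : realType) (M n Nc : nat) d (T : measurableType d) (P : probability T R).
Variables (H : {RV P >-> 'M[R[i]]_(Nc, M)}) (Z : {RV P >-> 'M[R[i]]_(Nc, n)})
  (xi : {RV P >-> R[i]}).
Variables (v : R) (v0 : (0 < v)%R).
Hypotheses (hH : iid_complex_normal P H 1) (hZ : iid_complex_normal P Z v)
  (hind : independent3 P H Z xi).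
Variables (u : 'cV[R[i]]_M) (hu : (u^t* *m u) 0%R 0%R = 1%R).
Hypotheses (hM : (0 < M)%N) (hn : (0 < n)%N).
Variables (p alpha : R) (p0 : (0 < p)%R) (p1 : (p < 1)%R).
Hypothesis alphaE : (alpha ^+ 2 = p^-1)%R.
Hypotheses (xi0 : P (xi @^-1` [set 0%R]) = (1 - p)%:E)
  (xi1 : P (xi @^-1` [set alpha%:C%C]) = p%:E).

Let j0 : 'I_n := Ordinal hn.
Let X : {RV P >-> 'M[R[i]]_(M, n)} := flash_waveform n u xi.
Let Y : {RV P >-> 'M[R[i]]_(Nc, n)} := channel_output H X Z.
Let g : 'cV[R[i]]_M := (((Num.sqrt (M * n)%:R)%:C%C * alpha%:C%C) *: u)%R.
Let x1 : 'M[R[i]]_(M, n) := (g *m \row_j (j == j0)%:R)%R.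

(** The SNR of the active column while the symbol is on: the energy [M n / p] of the waveform over
    the noise variance [v]. *)
Let s : R := ((M * n)%:R / (p * v))%R.

Let s0 : (0 < s)%R.
Proof. by rewrite divr_gt0 ?mulr_gt0// ltr0n muln_gt0 hM. Qed.

Let sum_sqnormc_u : (\sum_k sqnormc (u k 0) = 1)%R.
Proof.
move: hu; rewrite mxE => /(congr1 (@complex.Re R)) /= <-.
rewrite raddf_sum; apply: eq_bigr => k _; rewrite !mxE.
by case: (u k 0%R) => x y; rewrite /sqnormc/= mulNr opprK !expr2.
Qed.

Let sqnormcZ (r : R) (z : R[i]) : (sqnormc (r%:C%C * z) = r ^+ 2 * sqnormc z)%R.
Proof. by case: z => x y; rewrite /sqnormc/=; ring. Qed.

Let sum_sqnormc_g : (\sum_k sqnormc (g k 0) = s * v)%R.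
Proof.
transitivity (\sum_k ((M * n)%:R / p) * sqnormc (u k 0))%R.
  apply: eq_bigr => k _; rewrite !mxE -mulrA !sqnormcZ mulrA sqr_sqrtr//.
  by rewrite alphaE.
rewrite -mulr_sumr sum_sqnormc_u mulr1 /s.
by field; rewrite !gt_eqF.
Qed.

Let w := (v * (1 + s))%R.

Let vw : (v <= w)%R. Proof. by rewrite ler_pMr// lerDl ltW. Qed.

Let rowE : (\row_(j < n) (j == 0%N :> nat)%:R = \row_j (j == j0)%:R :> 'rV[R[i]]_n)%R.
Proof. by apply/rowP => j; rewrite !mxE. Qed.

Let mH : measurable_fun setT H. Proof. exact: measurable_funP. Qed.
Let mZ : measurable_fun setT Z. Proof. exact: measurable_funP. Qed.

Let alpha_neq0 : alpha != 0%R.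
Proof.
by apply/eqP => a0; move: alphaE; rewrite a0 expr0n/= => /esym/eqP; rewrite invr_eq0 gt_eqF.
Qed.

Let XE t : X t = (((Num.sqrt (M * n)%:R)%:C%C * xi t) *: (u *m \row_j (j == j0)%:R))%R.
Proof. by rewrite -rowE. Qed.

Let x1E : x1 = (((Num.sqrt (M * n)%:R)%:C%C * alpha%:C%C) *: (u *m \row_j (j == j0)%:R))%R.
Proof. by rewrite /x1 /g -scalemxAl. Qed.

Let urow_neq0 : (u *m \row_j (j == j0)%:R != 0 :> 'M[R[i]]_(M, n))%R.
Proof.
apply/eqP => u0; have : (\sum_k sqnormc (u k 0) = 0)%R.
  apply: big1 => k _; move/matrixP/(_ k j0): u0.
  by rewrite !mxE big_ord1 !mxE eqxx mulr1 => ->; rewrite /sqnormc/= expr0n addr0.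
by rewrite sum_sqnormc_u => /eqP; rewrite oner_eq0.
Qed.

Let sqrtMn_neq0 : ((Num.sqrt (M * n)%:R)%:C%C != 0 :> R[i])%R.
Proof.
rewrite (_ : 0%R = 0%:C%C)// (inj_eq (@complexI R)) gt_eqF// sqrtr_gt0 ltr0n.
by rewrite muln_gt0 hM.
Qed.

(** The waveform depends injectively on the symbol because [u e_1^T] is nonzero, so the atoms of [X]
    and of [xi] define the same events. *)
Let X0 : X @^-1` [set 0%R] = xi @^-1` [set 0%R].
Proof.
apply/seteqP; split=> t /=; rewrite XE.
  by move/eqP; rewrite scaler_eq0 (negbTE urow_neq0) orbF mulf_eq0
    (negbTE sqrtMn_neq0)/= => /eqP.
by move=> ->; rewrite mulr0 scale0r.
Qed.

Let X1 : X @^-1` [set x1] = xi @^-1` [set alpha%:C%C].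
Proof.
apply/seteqP; split=> t /=; rewrite XE x1E.
  move/eqP; rewrite -subr_eq0 -scalerBl scaler_eq0 (negbTE urow_neq0) orbF.
  by rewrite -mulrBr mulf_eq0 (negbTE sqrtMn_neq0)/= subr_eq0 => /eqP.
by move=> ->.
Qed.

Let x01 : 0%R <> x1.
Proof.
move/esym/eqP; rewrite x1E scaler_eq0 (negbTE urow_neq0) orbF mulf_eq0.
rewrite (negbTE sqrtMn_neq0)/= (_ : 0%R = 0%:C%C)// (inj_eq (@complexI R)).
by rewrite (negbTE alpha_neq0).
Qed.

Let Q := distribution P Z.

Let QP : product_law (1%:nng)%R Q (fun k (y : 'M[R[i]]_(Nc, n)) => y k.1 k.2)
  (fun=> cnormal v).
Proof. by move=> E mE; exact: (iid_complex_normal_law hZ). Qed.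

Let mB z : measurable (xi @^-1` [set z]).
Proof.
rewrite -[X in measurable X]setTI; apply: measurable_funP => //.
exact: measurable_set1_complex.
Qed.

Let C : {nonneg R} := NngNum (ltW p0).

(** Independence of [xi] makes the restriction to its on-event multiply every rectangle probability
    of [(Z, H)] by the same mass [p]. *)
Let base : product_law C (mrestr P (mB alpha%:C%C))
  (fun (k : 'I_Nc * 'I_n + 'I_Nc * 'I_M) t =>
     match k with inl ij => Z t ij.1 ij.2 | inr ik => H t ik.1 ik.2 end)
  (fun k => if k is inl _ then cnormal v else cnormal 1).
Proof.
move=> E mE; rewrite /mrestr.
pose EZ : set 'M[R[i]]_(Nc, n) :=
  \bigcap_(k : 'I_Nc * 'I_n) ((fun y => y k.1 k.2) @^-1` E (inl k)).
pose EH : set 'M[R[i]]_(Nc, M) :=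
  \bigcap_(k : 'I_Nc * 'I_M) ((fun y => y k.1 k.2) @^-1` E (inr k)).
have mEZ : measurable EZ.
  exact: (@measurable_mx_rectangle _ _ _ _ (fun k => E (inl k)) (fun k => mE _)).
have mEH : measurable EH.
  exact: (@measurable_mx_rectangle _ _ _ _ (fun k => E (inr k)) (fun k => mE _)).
rewrite (_ : _ `&` _ = H @^-1` EH `&` Z @^-1` EZ `&` xi @^-1` [set alpha%:C%C]); last first.
  apply/seteqP; split=> t [].
    move=> Et xit; split=> //; split=> k _ /=; first exact: (Et (inr k) Logic.I).
    exact: (Et (inl k) Logic.I).
  by move=> [Ht Zt] xit; split=> // -[k|k] _ /=; [have := Zt k Logic.I|have := Ht k Logic.I].
rewrite (independent3P hind mEH mEZ (measurable_set1_complex _)).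
rewrite (iid_complex_normal_law hH (fun k => mE (inr k))).
rewrite (iid_complex_normal_law hZ (fun k => mE (inl k))).
by rewrite [X in _ * X]xi1 !mul1e muleC big_sumType/= [X in _ * X = _]muleC.
Qed.

Let mYx1 : measurable_fun setT (fun t => (H t *m x1 + Z t)%R).
Proof.
by apply: measurable_fun_addmx => //; apply: measurable_fun_mulmx => //; exact: measurable_cst.
Qed.

(** On this event [Y = H *m x1 + Z], and the entries of column [j0] have variance
    [v + s * v = w]. *)
Let PX1 A : measurable A -> P (X @^-1` [set x1] `&` Y @^-1` A) =
  p%:E * \int[Q]_(y in A) (expR (likelihood_exponent j0 v w y - @likelihood_shift R Nc v w))%:E.
Proof.
move=> mA; have ch := product_law_channel mZ mH v0 g j0 base.
have mP : product_law C (image_measure (mrestr P (mB alpha%:C%C)) mYx1)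
    (fun k (y : 'M[R[i]]_(Nc, n)) => y k.1 k.2) (tilted_law j0 v w).
  move=> E mE; have := ch E mE.
  rewrite (eq_bigr (fun k => tilted_law j0 v w k (E k))) => [<-//|k _].
  rewrite /tilted_law; case: (k.2 == j0); last by rewrite addr0.
  by rewrite sum_sqnormc_g /w mulrDr mulr1 [(s * v)%R]mulrC.
rewrite -[RHS](tilted_law_density v0 vw QP mP mA).
rewrite /image_measure /pushforward /mrestr X1 setIC; congr (P _).
have YE t : xi t = alpha%:C%C -> Y t = (H t *m x1 + Z t)%R.
  by move=> xt; rewrite /Y /= /channel_output -[X t]/(X t) XE xt -x1E.
by apply/seteqP; split=> t [/= + xt]; rewrite (YE t xt).
Qed.

Let PX0 A : measurable A -> P (X @^-1` [set 0%R] `&` Y @^-1` A) = (1 - p)%:E * Q A.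
Proof.
move=> mA; rewrite X0.
rewrite (_ : _ `&` _ = H @^-1` setT `&` Z @^-1` A `&` xi @^-1` [set 0%R]).
  rewrite (independent3P hind measurableT mA (measurable_set1_complex _)).
  by rewrite preimage_setT probability_setT mul1e muleC [X in X * _]xi0.
have YE t : X t = 0%R -> Y t = Z t.
  by move=> Xt; rewrite -[RHS]add0r -(mulmx0 _ (H t)) -Xt.
have XiE t : xi t = 0%R -> X t = 0%R by move=> xt; rewrite XE xt mulr0 scale0r.
apply/seteqP; split=> t /=.
  by move=> [xt]; rewrite (YE t (XiE t xt)).
by move=> [[_ At] xt]; split=> //; rewrite (YE t (XiE t xt)).
Qed.

Lemma flash_mutual_information : exists r : R,
  [/\ mutual_information X Y = (r / ln 2)%:E,
      (r <= p * (Nc%:R * s - Nc%:R * ln (1 + s)))%R &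
      (p * (Nc%:R * s - Nc%:R * ln (1 + s)) -
       p * (ln 2 + (32 * Nc%:R ^+ 2 * s ^+ 2) / (4 * - ln p)) <= r)%R].
Proof.
have wv : (w / v = 1 + s)%R by rewrite /w mulrAC divff ?mul1r// gt_eqF.
have h1 := integral_likelihood_exponent j0 v0 vw QP.
have h2 := integral_sqr_likelihood_exponent_le j0 v0 vw QP.
have := on_off_mutual_information_bounds x01 _ _ p0 p1
  (measurable_likelihood_exponent j0 v w) (likelihood_exponent_ge0 j0 v0 vw)
  (@likelihood_shift_ge0 R Nc v w v0 vw) (integral_likelihood j0 v0 vw QP) PX0 PX1
  (integrable_likelihood_exponent j0 v0 vw QP) h1 h2.
have sE : (1 + s - 1 = s)%R by rewrite addrAC subrr add0r.
rewrite /likelihood_shift wv !sE; apply.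
- by apply: measurable_set1_mx; exact: measurable_set1_complex.
- by apply: measurable_set1_mx; exact: measurable_set1_complex.
Qed.

End flash_channel.

(** * The flash law and its low-SNR asymptotics *)

Section flash_law.
Context (R : realType) (n : nat).
Implicit Types snr : R.

(* As soon as flash_prob < 1, this is the SNR of the first channel use while
   the symbol is on.  It tends to infinity, so the logarithmic loss is of lower
   order, but its square stays below ln (1 / flash_prob). *)
Definition flash_gain snr : R := Num.sqrt (ln (1 + snr^-1)).

(** The minimum makes this a probability for every positive SNR; for small SNR the second argument
    is the smaller one. *)
Definition flash_prob snr : R := Num.min 1 (n%:R * snr / flash_gain snr).

Definition flash_symbol snr (b : bool) : R[i] :=
  if b then (Num.sqrt (flash_prob snr)^-1)%:C else 0.

HB.instance Definition _ snr :=
  isMeasurableFun.Build _ _ bool R[i] (flash_symbol snr)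
    (fun=> fun=> fun=> (Logic.I : measurable (_ : set bool))).

Definition flash_law snr : probability R[i] R :=
  distribution (bernoulli_prob (flash_prob snr)) (flash_symbol snr).

Hypothesis n0 : (0 < n)%N.

Lemma flash_gain_gt0 snr : 0 < snr -> 0 < flash_gain snr.
Proof.
by move=> snr0; rewrite sqrtr_gt0 ln_gt0// ltrDl invr_gt0.
Qed.

Lemma flash_prob_gt0 snr : 0 < snr -> 0 < flash_prob snr.
Proof.
move=> snr0; rewrite lt_min ltr01 divr_gt0 ?flash_gain_gt0// mulr_gt0// ltr0n//.
Qed.

Lemma flash_prob_le1 snr : flash_prob snr <= 1.
Proof. by rewrite ge_min lexx. Qed.

Let prob01 snr : 0 < snr -> 0 <= flash_prob snr <= 1.
Proof. by move=> snr0; rewrite flash_prob_le1 (ltW (flash_prob_gt0 snr0)). Qed.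

Let amplitude_gt0 snr : 0 < snr -> 0 < Num.sqrt (flash_prob snr)^-1.
Proof. by move=> snr0; rewrite sqrtr_gt0 invr_gt0 flash_prob_gt0. Qed.

Lemma flash_law_normc2 snr : 0 < snr ->
  (\int[flash_law snr]_x ((Normc.normc x) ^+ 2)%:E = 1)%E.
Proof.
move=> snr0; have sqE (x : R[i]) : Normc.normc x ^+ 2 = sqnormc x.
  by case: x => a b; rewrite /sqnormc/= sqr_sqrtr// addr_ge0// sqr_ge0.
under eq_integral do rewrite sqE.
rewrite ge0_integral_distribution.
- rewrite integral_bernoulli_prob.
  + rewrite /= /sqnormc/= !expr0n/= !addr0 mule0 adde0 -EFinM sqr_sqrtr.
      by rewrite divff// gt_eqF// flash_prob_gt0.
    by rewrite invr_ge0 (ltW (flash_prob_gt0 snr0)).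
  + exact: prob01.
  + by move=> b; rewrite lee_fin sqnormc_ge0.
- by apply/measurable_EFinP; exact: measurable_sqnormc.
- by move=> y; rewrite lee_fin sqnormc_ge0.
Qed.

Lemma flash_law_zero snr : 0 < snr ->
  flash_law snr [set 0] = (1 - flash_prob snr)%:E.
Proof.
move=> snr0; rewrite /flash_law /distribution/= /pushforward.
rewrite bernoulli_probE ?prob01// !diracE.
rewrite memNset ?mem_set//=.
  by rewrite mule0 add0e mule1.
move/(congr1 (@complex.Re R)) => /= a0.
by have := amplitude_gt0 snr0; rewrite a0 ltxx.
Qed.

Lemma flash_law_amplitude snr : 0 < snr ->
  flash_law snr [set (Num.sqrt (flash_prob snr)^-1)%:C] = (flash_prob snr)%:E.
Proof.
move=> snr0; rewrite /flash_law /distribution/= /pushforward.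
rewrite bernoulli_probE ?prob01// !diracE.
rewrite mem_set// memNset//=.
  by rewrite mule0 adde0 mule1.
move/(congr1 (@complex.Re R)) => /= a0.
by have := amplitude_gt0 snr0; rewrite -a0 ltxx.
Qed.

Lemma near_flash_gain_ge (A : R) : \forall snr \near 0^'+, A <= flash_gain snr.
Proof.
near=> snr.
have snr0 : 0 < snr by [].
have : snr < expR (- A ^+ 2) by near: snr; apply: nbhs_right_lt; exact: expR_gt0.
move=> snrA; have : A ^+ 2 <= ln (1 + snr^-1).
  rewrite -ler_expR lnK ?posrE ?addr_gt0 ?invr_gt0//.
  rewrite (@le_trans _ _ snr^-1)// ?lerDr//.
  by rewrite -[leLHS]invrK lef_pV2 ?posrE ?invr_gt0 ?expR_gt0// -expRN (ltW snrA).
move=> /(@ler_wsqrtr R); rewrite sqrtr_sqr; apply: le_trans; exact: ler_norm.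
Unshelve. all: by end_near. Qed.

Lemma flash_law_zero_cvg : flash_law snr [set 0] @[snr --> 0^'+] --> 1%E.
Proof.
have : (1 - flash_prob snr)%:E @[snr --> 0^'+] --> (1 - 0)%:E.
  apply: cvg_EFin; first by near=> snr.
  apply: cvgB; first exact: cvg_cst.
  apply/cvgr0Pnorm_le => e e0; near=> snr.
  have snr0 : 0 < snr by [].
  rewrite gtr0_norm ?flash_prob_gt0// ge_min; apply/orP; right.
  rewrite ler_pdivrMr ?flash_gain_gt0// (@le_trans _ _ e)//.
    have : snr < e / n%:R by near: snr; apply: nbhs_right_lt; rewrite divr_gt0// ltr0n.
    by rewrite ltr_pdivlMr ?ltr0n// mulrC => /ltW.
  by rewrite ler_peMr ?(ltW e0)//; near: snr; exact: near_flash_gain_ge.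
rewrite subr0; apply: cvg_trans; apply: near_eq_cvg; near=> snr.
by rewrite flash_law_zero.
Unshelve. all: by end_near. Qed.

End flash_law.

Section flash_rate.
Context (R : realType) (n Nc : nat).
Hypothesis n0 : (0 < n)%N.

(** The terms of the constant bound three losses: [4 * Nc] comes from [ln (1 + s) <= 4 * sqrt s], 1
    from [ln 2 <= 1], and [8 * Nc ^+ 2] from [s ^+ 2 <= - ln p]. As [sqrt s >= 1], all are at most
    multiples of [sqrt s], against a main term of order [s]. *)
Lemma flash_rate_bounds (snr rate : R) : 0 < snr -> snr <= 1 ->
    1 <= flash_gain snr -> 2 * n%:R <= flash_gain snr ->
    let p := flash_prob n snr in let s := flash_gain snr in
    rate <= p * (Nc%:R * s - Nc%:R * ln (1 + s)) ->
    p * (Nc%:R * s - Nc%:R * ln (1 + s)) -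
      p * (ln 2 + 32 * Nc%:R ^+ 2 * s ^+ 2 / (4 * - ln p)) <= rate ->
  `|rate - Nc%:R * n%:R * snr| <=
    n%:R * snr * (4 * Nc%:R + 1 + 8 * Nc%:R ^+ 2) / Num.sqrt s.
Proof.
move=> snr0 snr1 s1 s2n p s ub lb.
have s0 : 0 < s by exact: lt_le_trans s1.
have n0R : 0 < n%:R :> R by rewrite ltr0n.
have pE : p = n%:R * snr / s.
  apply/min_idPr; rewrite ler_pdivrMr// mul1r (le_trans _ s2n)//.
  by rewrite [leLHS]mulrC ler_wpM2r ?(ltW n0R)// (le_trans snr1)// ler1n.
have p0 : 0 < p by exact: flash_prob_gt0.
have psE : p * s = n%:R * snr by rewrite pE divfK// gt_eqF.
(* From [2 n <= s] one gets [p <= snr / 2], and [2 / snr >= 1 + 1 / snr] as [snr <= 1]. This is what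
   bounds [s ^+ 2] by [- ln p]. *)
have pinv : 1 + snr^-1 <= p^-1.
  have snrV1 : 1 <= snr^-1 by rewrite invf_ge1.
  rewrite pE invf_div (@le_trans _ _ (2 / snr))//.
    by rewrite mulr_natl mulr2n lerD2r.
  by rewrite invfM mulrA ler_wpM2r ?invr_ge0 ?(ltW snr0)// ler_pdivlMr.
have lnp : s ^+ 2 <= - ln p.
  rewrite -lnV ?posrE// sqr_sqrtr; last by rewrite ln_ge0// lerDl invr_ge0 (ltW snr0).
  by rewrite ler_ln ?posrE ?invr_gt0// addr_gt0 ?invr_gt0.
have s20 : 0 < s ^+ 2 by rewrite exprn_gt0.
have lnp0 : 0 < - ln p by exact: lt_le_trans lnp.
have err : 32 * Nc%:R ^+ 2 * s ^+ 2 / (4 * - ln p) <= 8 * Nc%:R ^+ 2.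
  rewrite ler_pdivrMr ?mulr_gt0// [leRHS](_ : _ = 32 * Nc%:R ^+ 2 * - ln p); last by ring.
  by rewrite ler_wpM2l// mulr_ge0// sqr_ge0.
set t := Num.sqrt s.
have t1 : 1 <= t by rewrite -[leLHS]sqrtr1 ler_wsqrtr.
have t0 : 0 < t by exact: lt_le_trans t1.
have tE : t ^+ 2 = s by rewrite sqr_sqrtr// (ltW s0).
have ln0 : 0 <= ln (1 + s) by rewrite ln_ge0// lerDl (ltW s0).
(* Since [s = t ^+ 2], [1 + s <= (1 + t) ^+ 2], whose logarithm is at most [2 * t]. *)
have ln1s : ln (1 + s) <= 4 * t.
  have : ln (1 + s) <= ln ((1 + t) ^+ 2).
    by rewrite ler_ln ?posrE ?exprn_gt0 ?addr_gt0// -tE; nra.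
  move=> /le_trans; apply.
  rewrite lnXn ?addr_gt0// -mulr_natl.
  have : ln (1 + t) <= t by apply: le_ln1Dx; rewrite (@lt_trans _ _ 0).
  by move: t1; lra.
have ln2 : ln 2 <= 1 :> R.
  by rewrite (_ : 2 = 1 + 1)//; apply: le_ln1Dx; rewrite (@lt_trans _ _ 0).
have Nc0 : 0 <= Nc%:R :> R by [].
have -> : n%:R * snr * (4 * Nc%:R + 1 + 8 * Nc%:R ^+ 2) / t =
    p * ((4 * Nc%:R + 1 + 8 * Nc%:R ^+ 2) * t).
  by rewrite -psE -tE; field; rewrite gt_eqF.
have -> : Nc%:R * n%:R * snr = p * (Nc%:R * s).
  by rewrite mulrCA psE mulrA.
have Nct : 0 <= (1 + 8 * Nc%:R ^+ 2) * (t - 1) :> R.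
  by rewrite mulr_ge0 ?subr_ge0// addr_ge0// mulr_ge0// sqr_ge0.
have Ncl : Nc%:R * ln (1 + s) <= Nc%:R * (4 * t) by rewrite ler_wpM2l.
have Ncl0 : 0 <= Nc%:R * ln (1 + s) by rewrite mulr_ge0.
have bound : Nc%:R * ln (1 + s) + ln 2 + 8 * Nc%:R ^+ 2 <=
    (4 * Nc%:R + 1 + 8 * Nc%:R ^+ 2) * t by lra.
have K0 : 0 <= (4 * Nc%:R + 1 + 8 * Nc%:R ^+ 2) * t.
  by rewrite mulr_ge0 ?(ltW t0)// !addr_ge0 ?mulr_ge0// sqr_ge0.
rewrite ler_norml; apply/andP; split.
- rewrite lerBrDr addrC; apply: le_trans lb.
  by rewrite -!mulrBr ler_pM2l//; lra.
- rewrite lerBlDr; apply: (le_trans ub).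
  by rewrite -mulrDr ler_pM2l//; lra.
Qed.

End flash_rate.

Lemma first_order_expansion (R : realType) (n Nc : nat) (K : R) (f : R -> \bar R) :
    (0 < n)%N -> 0 < K ->
    (\forall snr \near 0^'+, exists2 rate, f snr = (rate / ln 2)%:E &
       `|rate - Nc%:R * n%:R * snr| <= n%:R * snr * K / Num.sqrt (flash_gain snr)) ->
  exists2 r : R -> R, r =o_ (0^'+) (fun snr => snr)
    & \forall snr \near 0^'+,
        (n%:R^-1%:E * f snr = (Nc%:R * log2 (expR 1) * snr + r snr)%:E)%E.
Proof.
move=> n0 K0 fE; have n0R : 0 < n%:R :> R by rewrite ltr0n.
have ln20 : 0 < ln 2 :> R by rewrite ln_gt0// ltr1n.
have log2e : log2 (expR 1) = (ln 2)^-1 :> R by rewrite /log2 expRK div1r.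
(* The remainder must be a real function everywhere, whereas [f] is known to be finite only near 0;
   hence [fine]. *)
exists (fun snr => n%:R^-1 * fine (f snr) - Nc%:R / ln 2 * snr).
  apply/eqoP => e e0; near=> snr.
  have snr0 : 0 < snr by [].
  have [rate -> rateE] : exists2 rate, f snr = (rate / ln 2)%:E &
      `|rate - Nc%:R * n%:R * snr| <= n%:R * snr * K / Num.sqrt (flash_gain snr).
    by near: snr.
  (* This threshold makes the relative error [K / sqrt gain] at most [e * ln 2]; the factor [ln 2]
     accounts for the change from nats to bits. *)
  have gain : (K / (e * ln 2)) ^+ 2 <= flash_gain snr.
    by near: snr; exact: near_flash_gain_ge.
  have c0 : 0 < K / (e * ln 2) by rewrite divr_gt0// mulr_gt0.
  have tE : K / (e * ln 2) <= Num.sqrt (flash_gain snr).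
    by rewrite -[leLHS]ger0_norm ?(ltW c0)// -sqrtr_sqr ler_wsqrtr.
  have t0 : 0 < Num.sqrt (flash_gain snr) by exact: lt_le_trans tE.
  rewrite /= (_ : _ - _ = (rate - Nc%:R * n%:R * snr) / (n%:R * ln 2)); last first.
    by field; rewrite !gt_eqF.
  rewrite normrM normfV [X in _ / X]gtr0_norm ?mulr_gt0//.
  rewrite ler_pdivrMr ?mulr_gt0//; apply: (le_trans rateE).
  rewrite gtr0_norm// ler_pdivrMr//.
  move: tE; rewrite ler_pdivrMr ?mulr_gt0// => /(ler_wpM2l (ltW (mulr_gt0 n0R snr0))).
  by move=> /le_trans; apply; rewrite le_eqVlt; apply/orP; left; apply/eqP; ring.
near=> snr.
have [rate -> _] : exists2 rate, f snr = (rate / ln 2)%:E &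
    `|rate - Nc%:R * n%:R * snr| <= n%:R * snr * K / Num.sqrt (flash_gain snr).
  by near: snr.
by rewrite -EFinM log2e /=; congr EFin; ring.
Unshelve. all: by end_near. Qed.

Section flash_information.
Context (R : realType) (M n Nc : nat) d (T : measurableType d) (P : probability T R).
Variables (H : {RV P >-> 'M[R[i]]_(Nc, M)}) (Z : R -> {RV P >-> 'M[R[i]]_(Nc, n)})
  (xi : R -> {RV P >-> R[i]}) (u : 'cV[R[i]]_M).

Lemma flash_first_order_information :
    (0 < M)%N -> (0 < n)%N -> (u^t* *m u) 0 0 = 1 ->
    iid_complex_normal P H 1 ->
    (forall snr, 0 < snr -> [/\ iid_complex_normal P (Z snr) (M%:R / snr),
       has_law P (xi snr) (flash_law n snr) & independent3 P H (Z snr) (xi snr)]) ->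
  let X snr : {RV P >-> 'M[R[i]]_(M, n)} := flash_waveform n u (xi snr) in
  let Y snr : {RV P >-> 'M[R[i]]_(Nc, n)} := channel_output H (X snr) (Z snr) in
  exists2 r : R -> R, r =o_ (0^'+) (fun snr => snr)
    & \forall snr \near 0^'+,
        (n%:R^-1%:E * mutual_information (X snr) (Y snr))%E =
        (Nc%:R * log2 (expR 1) * snr + r snr)%:E.
Proof.
move=> M0 n0 u1 hH hZ X Y.
apply: (@first_order_expansion _ _ _ (4 * Nc%:R + 1 + 8 * Nc%:R ^+ 2)) => //.
near=> snr.
have snr0 : 0 < snr by [].
have snr1 : snr <= 1 by near: snr; apply: nbhs_right_le.
have g1 : 1 <= flash_gain snr by near: snr; exact: near_flash_gain_ge.
have g2 : 2 * n%:R <= flash_gain snr by near: snr; exact: near_flash_gain_ge.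
have n0R : 0 < n%:R :> R by rewrite ltr0n.
have M0R : 0 < M%:R :> R by rewrite ltr0n.
have [hZs lawxi ind] := hZ snr snr0.
have g0 := flash_gain_gt0 snr0.
have lt1 : n%:R * snr / flash_gain snr < 1.
  rewrite ltr_pdivrMr// mul1r (lt_le_trans _ g2)//.
  rewrite (@le_lt_trans _ _ n%:R)//; first by rewrite ler_piMr// (ltW n0R).
  by rewrite mulr_natl mulr2n ltrDl.
have pE : flash_prob n snr = n%:R * snr / flash_gain snr by apply/min_idPr/ltW.
have p0 := flash_prob_gt0 n0 snr0.
have p1 : flash_prob n snr < 1 by rewrite pE.
have v0 : 0 < M%:R / snr by rewrite divr_gt0.
have xi0 : P (xi snr @^-1` [set 0]) = (1 - flash_prob n snr)%:E.
  by rewrite lawxi ?flash_law_zero//; exact: measurable_set1_complex.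
have xi1 : P (xi snr @^-1` [set (Num.sqrt (flash_prob n snr)^-1)%:C]) =
    (flash_prob n snr)%:E.
  by rewrite lawxi ?flash_law_amplitude//; exact: measurable_set1_complex.
have aE : Num.sqrt (flash_prob n snr)^-1 ^+ 2 = (flash_prob n snr)^-1.
  by rewrite sqr_sqrtr// invr_ge0 (ltW p0).
have [rate [-> ub lb]] := flash_mutual_information v0 hH hZs ind u1 M0 n0 p0 p1 aE xi0 xi1.
exists rate => //.
(* With noise variance [M / snr] the abstract SNR of the active column is [n * snr / p], which the
   choice of [p] makes equal to the gain. *)
have sE : (M * n)%:R / (flash_prob n snr * (M%:R / snr)) = flash_gain snr.
  by rewrite pE natrM; field; rewrite !gt_eqF.
rewrite sE in ub lb.
exact: (flash_rate_bounds n0 snr0 snr1 g1 g2 ub lb).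
Unshelve. all: by end_near. Qed.

End flash_information.

(** * Sensing optimality *)

Section hermitian_trace.
Context {C : numClosedFieldType} {n : nat}.
Implicit Types (A S : 'M[C]_n) (u x : 'cV[C]_n).

Lemma possemidefmx_scale_outer (c : C) u : 0 <= c ->
  possemidefmx (c *: (u *m u^t*)).
Proof.
move=> c0; split.
  apply/is_hermitianmxP; rewrite expr0 scale1r; apply/matrixP => i j.
  rewrite !mxE !big_ord1 !mxE !rmorphM/= conjCK (geC0_conj c0).
  by rewrite [u i 0 * _]mulrC.
move=> x; rewrite -scalemxAr -scalemxAl mxE mulr_ge0//.
rewrite mulmxA -[_ *m _ *m x]mulmxA mxE big_ord1.
rewrite (_ : (x^t* *m u) 0 0 = ((u^t* *m x) 0 0)^*); first by rewrite mulrC mul_conjC_ge0.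
rewrite !mxE rmorph_sum; apply: eq_bigr => k _.
by rewrite !mxE rmorphM/= conjCK mulrC.
Qed.

Lemma mxtrace_outer u x : \tr (u *m x^t*) = (x^t* *m u) 0 0.
Proof. by rewrite mxtrace_mulC /mxtrace big_ord1. Qed.

(** In an orthonormal eigenbasis the trace is a sum of squared eigenvalues with weights
    [x_k^* S x_k >= 0]. Positivity of [A] enters through [D0]: from an upper bound alone, a very
    negative eigenvalue could still have a large square. *)
Lemma mxtrace_sqr_posdef_le A S (a : C) :
    posdefmx A -> largest_eigenvalue A a -> possemidefmx S ->
  \tr (A *m A *m S) <= a ^+ 2 * \tr S.
Proof.
move=> [Aherm Apos] [_ amax] [_ Spos].
have /orthomx_spectralP AE := hermitian_normalmx Aherm.
set U := spectralmx A in AE; set D := spectral_diag A in AE.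
have Uu : U \is unitarymx := spectral_unitarymx A.
have Uunit : U \in unitmx := spectral_unit A.
rewrite invmx_unitary// in AE.
have UUt : U *m U^t* = 1%:M by apply/unitarymxP.
have UA : U *m A = diag_mx D *m U by rewrite {1}AE !mulmxA UUt mul1mx.
pose x k : 'cV[C]_n := (row k U)^t*.
have rowA k : row k U *m A = D 0 k *: row k U.
  by rewrite -row_mul UA mul_diag_mx; apply/rowP => i; rewrite !mxE.
have xt k : (x k)^t* = row k U by rewrite /x trmxCK.
have xx k : (row k U *m x k) 0 0 = 1.
  transitivity ((U *m U^t*) k k); last by rewrite UUt mxE eqxx.
  by rewrite !mxE; apply: eq_bigr => i _; rewrite !mxE.
have x0 k : x k != 0.
  by apply/eqP => xk; have := xx k; rewrite xk mulmx0 mxE => /esym/eqP; rewrite oner_eq0.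
have D0 k : 0 <= D 0 k.
  have := Apos _ (x0 k); rewrite xt rowA -scalemxAl mxE xx mulr1; exact: ltW.
have Da k : D 0 k <= a.
  apply: amax; apply/eigenvalueP; exists (row k U) => //.
  by apply/eqP => rk; have := xx k; rewrite rk mul0mx mxE => /esym/eqP; rewrite oner_eq0.
have entry k : (U *m S *m U^t*) k k = ((x k)^t* *m S *m x k) 0 0.
  by rewrite xt -row_mul !mxE; apply: eq_bigr => i _; rewrite !mxE.
have -> : \tr S = \sum_k ((x k)^t* *m S *m x k) 0 0.
  rewrite -[S in LHS]mulmx1 -[1%:M](_ : U^t* *m U = _); last first.
    by rewrite -invmx_unitary// mulVmx.
  by rewrite mulmxA mxtrace_mulC mulmxA; apply: eq_bigr => k _; rewrite entry.
have -> : \tr (A *m A *m S) = \sum_k (D 0 k) ^+ 2 * ((x k)^t* *m S *m x k) 0 0.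
  rewrite {1}AE -!mulmxA mxtrace_mulC.
  rewrite !mulmxA -[diag_mx D *m U *m A]mulmxA UA mulmxA mulmx_diag -!mulmxA.
  rewrite mul_diag_mx; apply: eq_bigr => k _.
  by rewrite -entry -mulmxA mxE [(\row__ _) 0 _]mxE expr2.
rewrite mulr_sumr; apply: ler_sum => k _.
by rewrite ler_wpM2r// lerXn2r// nnegrE// (le_trans (D0 k)).
Qed.

End hermitian_trace.

Section flash_covariance.
Context (R : realType) d (T : measurableType d) (P : probability T R).

Lemma cexpectation_scale (f : T -> R) (z : R[i]) :
    P.-integrable setT (EFin \o f) -> (\int[P]_w (f w)%:E = 1)%E ->
  cexpectation P (fun w => (f w)%:C * z) = z.
Proof.
move=> fi f1; have fE (k : R) : ('E_P[fun w => (f w * k)%R] = k%:E)%E.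
  rewrite unlock; under eq_integral do rewrite EFinM.
  by rewrite integralZr// f1 mul1e.
rewrite /cexpectation; case: z => a b.
rewrite (_ : (fun w => complex.Re _) = (fun w => f w * a)); last first.
  by apply/funext => w; rewrite /= mul0r subr0.
rewrite (_ : (fun w => complex.Im _) = (fun w => f w * b)); last first.
  by apply/funext => w; rewrite /= mul0r addr0.
by rewrite !fE.
Qed.

Variables (M n : nat) (u : 'cV[R[i]]_M) (xi : {RV P >-> R[i]}).
Variable mu : probability R[i] R.
Hypotheses (n0 : (0 < n)%N) (lawxi : has_law P xi mu)
  (mu1 : (\int[mu]_x ((Normc.normc x) ^+ 2)%:E = 1)%E).

Let sqE (x : R[i]) : Normc.normc x ^+ 2 = sqnormc x.
Proof. by case: x => a b; rewrite /sqnormc/= sqr_sqrtr// addr_ge0// sqr_ge0. Qed.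

Let int_xi : (\int[P]_w (sqnormc (xi w))%:E = 1)%E.
Proof.
rewrite -mu1; under [RHS]eq_integral do rewrite sqE.
transitivity (\int[distribution P xi]_x (sqnormc x)%:E)%E.
  rewrite ge0_integral_distribution//.
  - by apply/measurable_EFinP; exact: measurable_sqnormc.
  - by move=> x; rewrite lee_fin sqnormc_ge0.
by apply: eq_measure_integral => A mA _; exact: lawxi.
Qed.

Let integrable_xi : P.-integrable setT (EFin \o (sqnormc \o xi)).
Proof.
apply/integrableP; split.
  apply/measurable_EFinP; apply: measurableT_comp; first exact: measurable_sqnormc.
  exact: measurable_funP.
under eq_integral do rewrite /= ger0_norm ?sqnormc_ge0//.
by rewrite int_xi ltry.
Qed.

(** As [e *m e^t*] is 1, each entry of the outer product is the real random factor [sqnormc xi], of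
    mean 1, times a constant, as [cexpectation_scale] requires. *)
Lemma mxexpectation_flash_waveform :
  mxexpectation P (fun w => flash_waveform n u xi w *m (flash_waveform n u xi w)^t*) =
  (M * n)%:R *: (u *m u^t*).
Proof.
pose e : 'rV[R[i]]_n := \row_j (j == 0%N :> nat)%:R.
have ee : e *m e^t* = 1%:M.
  apply/matrixP => i j; rewrite !ord1 !mxE (bigD1 (Ordinal n0))//= !mxE/=.
  rewrite conjC1 mulr1 big1 ?addr0// => k k0; rewrite !mxE.
  by rewrite (_ : (k == 0%N :> nat) = false) ?mul0r//; apply: negbTE.
have cE (x : R[i]) : ((Num.sqrt (M * n)%:R)%:C * x) * ((Num.sqrt (M * n)%:R)%:C * x)^* =
    (sqnormc x)%:C * (M * n)%:R.
  have -> : (M * n)%:R = ((M * n)%:R)%:C :> R[i] by rewrite rmorph_nat.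
  have : Num.sqrt (M * n)%:R ^+ 2 = (M * n)%:R :> R by rewrite sqr_sqrtr.
  set t := Num.sqrt _ => <-; case: x => a b.
  by rewrite /sqnormc; apply/eqP; rewrite eq_complex/=; apply/andP; split; apply/eqP; ring.
have trZ (c : R[i]) (A : 'M[R[i]]_(M, n)) : (c *: A)^T = c *: A^T.
  by apply/matrixP => i j; rewrite !mxE.
apply/matrixP => i j; rewrite mxE -[RHS](cexpectation_scale _ integrable_xi int_xi).
congr cexpectation; apply/funext => w.
rewrite /flash_waveform -/e trZ map_mxZ -scalemxAr -scalemxAl scalerA [X in X *: _]mulrC.
rewrite trmx_mul map_mxM mulmxA -[_ *m e *m _]mulmxA ee mulmx1 [LHS]mxE cE.
by rewrite [in RHS]mxE mulrA.
Qed.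

End flash_covariance.

Theorem corollary1 (R : realType) (M T Nc : nat)
    (hM : (0 < M)%N) (hT : (0 < T)%N) (hNc : (0 < Nc)%N)
    (Rs : 'M[R[i]]_M) (hRs : posdefmx Rs)
    (lambda : R[i]) (hlambda : largest_eigenvalue Rs lambda)
    (u : 'cV[R[i]]_M) (hu : Rs *m u = lambda *: u)
    (hu1 : (u^t* *m u) 0 0 = 1) :
  exists mu : R -> probability R[i] R,
    [/\ forall snr, 0 < snr ->
          (\int[mu snr]_x ((Normc.normc x) ^+ 2)%:E = 1)%E,
        mu snr [set 0] @[snr --> 0^'+] --> 1%E
      & forall (d : measure_display) (Omega : measurableType d)
          (P : probability Omega R)
          (H : {RV P >-> 'M[R[i]]_(Nc, M)})
          (Z : R -> {RV P >-> 'M[R[i]]_(Nc, T)})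
          (xi : R -> {RV P >-> R[i]}),
        iid_complex_normal P H 1 ->
        (forall snr, 0 < snr ->
          [/\ iid_complex_normal P (Z snr) (M%:R / snr),
              has_law P (xi snr) (mu snr)
            & independent3 P H (Z snr) (xi snr)]) ->
        let X snr : {RV P >-> 'M[R[i]]_(M, T)} :=
          flash_waveform T u (xi snr) in
        let Y snr : {RV P >-> 'M[R[i]]_(Nc, T)} :=
          channel_output H (X snr) (Z snr) in
        (forall snr, 0 < snr ->
          let Sigma := mxexpectation P (fun w => X snr w *m (X snr w)^t*) in
          [/\ possemidefmx Sigma,
              \tr Sigma = (M * T)%:R
            & forall S : 'M[R[i]]_M, possemidefmx S -> \tr S = (M * T)%:R ->
                \tr (Rs *m Rs *m S) <= \tr (Rs *m Rs *m Sigma)]) /\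
        exists2 r : R -> R, r =o_ (0^'+) (fun snr => snr)
          & \forall snr \near 0^'+,
              (T%:R^-1%:E * mutual_information (X snr) (Y snr))%E =
              (Nc%:R * log2 (expR 1) * snr + r snr)%:E].
Proof.
exists (flash_law T); split.
- by move=> snr; exact: flash_law_normc2.
- exact: flash_law_zero_cvg.
move=> d Omega P H Z xi hH hZ X Y; split; last exact: flash_first_order_information.
move=> snr snr0 Sigma; have [_ lawxi _] := hZ snr snr0.
have SigmaE : Sigma = (M * T)%:R *: (u *m u^t*).
  exact: mxexpectation_flash_waveform hT lawxi (flash_law_normc2 hT snr0).
split.
- by rewrite SigmaE; exact: possemidefmx_scale_outer.
- by rewrite SigmaE mxtraceZ mxtrace_outer hu1 mulr1.
move=> S Spos trS.
(* Applying [hu] twice turns the right side into [lambda ^+ 2] times [M T], and [M T] is then read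
   as the trace of the competitor [S]. *)
rewrite SigmaE -scalemxAr mxtraceZ mulmxA -[Rs *m Rs *m u]mulmxA hu -scalemxAr hu.
rewrite scalerA -scalemxAl mxtraceZ mxtrace_outer hu1 mulr1 [leRHS]mulrC -trS -expr2.
exact: mxtrace_sqr_posdef_le.
Qed.
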